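(* Let $A^{\{1,3\}}_{132}(z)=\sum_{n\ge0}a_n z^n$, where $a_n$ is the number of permutations $\pi\in\mathfrak{S}_n$ that avoid $132$ and all of whose cycles have length $1$ or $3$ (with $a_0=1$). Let $c(x)=\frac{1-\sqrt{1-4x}}{2x}$ be the generating function of the Catalan numbers, let \[m(t,x)=\dfrac{2}{1-2tx+x+\sqrt{1-2x-3x^2}},\] and let $F(t,x)=1+xt\,m(t,x)$. Then \[ A^{\{1,3\}}_{132}(z)=\frac{1}{1-z}\,F\!\left(\frac{2}{1-z},\,c(z^3)-1\right), \] and equivalently \[ A^{\{1,3\}}_{132}(z)=\dfrac{c(z^3)}{\sqrt{c(z^3)\,(4-3c(z^3))}-z\,c(z^3)}. \]
   Context: $\mathfrak{S}_n$ is the symmetric group on $[n]$, with permutations written in one-line notation $\pi_1\cdots\pi_n$. A permutation contains a pattern $\sigma$ if some subsequence of its one-line notation is in the same relative order as $\sigma$; otherwise it avoids $\sigma$. The function $m(t,x)$ is the bivariate generating function $\sum_{k,j}M_{k,j}x^kt^j$ where $M_{k,j}$ is the number of Motzkin paths of length $k$ with exactly $j$ flat steps at height zero. *)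

(* Defs.v *)
From mathcomp Require Import all_boot all_fingroup.
From Stdlib Require Import Reals.
Set Implicit Arguments. Unset Strict Implicit. Unset Printing Implicit Defensive.

Definition contains132 (n : nat) (s : {perm 'I_n}) : bool :=
  [exists i : 'I_n, exists j : 'I_n, exists k : 'I_n,
     [&& (i < j)%N, (j < k)%N, (s i < s k)%N & (s k < s j)%N]].

Definition avoids132 (n : nat) (s : {perm 'I_n}) : bool := ~~ contains132 s.

Definition cycles13 (n : nat) (s : {perm 'I_n}) : bool :=
  [forall x : 'I_n, (#|porbit s x| == 1)%N || (#|porbit s x| == 3)%N].

Definition a13 (n : nat) : nat :=
  #|[set s : {perm 'I_n} | avoids132 s && cycles13 s]|.

Open Scope R_scope.

(* Catalan generating function c(x) = (1 - sqrt(1-4x))/(2x), extended by its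
   value c(0) = 1 at the removable singularity x = 0. *)
Definition catC (x : R) : R :=
  if Req_EM_T x 0 then 1 else (1 - sqrt (1 - 4 * x)) / (2 * x).

Definition mtx (t x : R) : R :=
  2 / (1 - 2 * t * x + x + sqrt (1 - 2 * x - 3 * x ^ 2)).

Definition Ftx (t x : R) : R := 1 + x * t * mtx t x.

(* Main.v *)
(* Let p avoid 132 and satisfy p^3 = 1, and let k be maximal such that p maps
   [k] outside [k].  Then p is increasing on the positions > k with value > k,
   so every 3-cycle has exactly one element <= k and reads t_j -> a_j -> b_j -> t_j
   with a_1 < ... < a_k and b_1 < ... < b_k.  Hence p is encoded by the
   132-avoider t of [k] and the word over {a, b, f} (f = fixed point) that
   describes k+1, ..., n.  Avoidance of 132 by p says exactly that a_j, a_(j+1)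
   and b_j, b_(j+1) are adjacent unless t_j is a right-to-left maximum, and that
   every f is preceded by as many a's as b's.  Thus t splits into r
   skew-indecomposable blocks, and the words are the ways of interleaving r
   blocks of a's with r blocks of b's, with f's at the balanced places.

   A skew-indecomposable 132-avoider has generating function I = 1 - 1/c in
   z^3, which satisfies I = z^3 + I^2.  Let H_d count the same objects with d
   additional blocks of b's.  Splitting off the first block gives
   H_0 = 1 + z H_0 + 2 I H_1 and H_d = I H_(d+1) + H_(d-1).  For small z the only
   solution of moderate growth in d has H_1 = K H_0 with I K^2 - K + 1 = 0, whence
   H_0 = 1 / (sqrt(1 - 4I) - z), and both closed forms reduce to this. *)
From Coquelicot Require Import Coquelicot.
Require Import Defs.
From mathcomp Require Import all_boot all_fingroup.
From Stdlib Require Import Reals Lra Lia.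
From mathcomp Require Import zify.
Open Scope R_scope.

Section Words.
Local Open Scope nat_scope.

(* [Some true], [Some false] and [None] are the letters a, b and f. *)
Definition letter := option bool.

Definition occ (c : bool) (w : seq letter) : seq nat :=
  [seq i <- iota 0 (size w) | nth None w i == Some c].

Definition rk (c : bool) (w : seq letter) (i : nat) : nat :=
  count_mem (Some c) (take i w).

Lemma rkS c (w : seq letter) i : rk c w i.+1 = rk c w i + (nth None w i == Some c).
Proof.
rewrite /rk; case: (ltnP i (size w)) => h.
  by rewrite (take_nth None h) -cats1 count_cat /= addn0.
by rewrite !take_oversize // ?nth_default // ?addn0 //; lia.
Qed.

Lemma rk0 c w : rk c w 0 = 0.
Proof. by rewrite /rk take0. Qed.

Lemma rk_cons c l w i : rk c (l :: w) i.+1 = (l == Some c) + rk c w i.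
Proof. by []. Qed.

Lemma leq_rk c w i j : i <= j -> rk c w i <= rk c w j.
Proof.
move=> /subnKC <-; elim: (j - i) => [|d IH]; first by rewrite addn0.
by rewrite addnS rkS; lia.
Qed.

Lemma ltn_rk c w i j : i < j -> nth None w i = Some c -> rk c w i < rk c w j.
Proof. by move=> /(leq_rk c w); rewrite rkS => h /eqP e; rewrite e in h; lia. Qed.

Lemma size_filter_iota c (w : seq letter) i :
  size [seq j <- iota 0 i | nth None w j == Some c] = rk c w i.
Proof.
elim: i => [|i IH]; first by rewrite rk0.
by rewrite -addn1 iotaD filter_cat size_cat IH addn1 rkS /= add0n; case: eqP.
Qed.

Lemma size_occ c (w : seq letter) : size (occ c w) = rk c w (size w).
Proof. exact: size_filter_iota. Qed.

Lemma letter_size c (w : seq letter) i : nth None w i = Some c -> i < size w.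
Proof. by case: (ltnP i (size w)) => // h; rewrite nth_default. Qed.

Lemma mem_occ c w i : (i \in occ c w) = (nth None w i == Some c).
Proof.
rewrite mem_filter mem_iota /= add0n; case: eqP => //= h.
exact: letter_size h.
Qed.

Lemma occ_uniq c w : uniq (occ c w).
Proof. by rewrite filter_uniq // iota_uniq. Qed.

Lemma occ_sorted c w : sorted ltn (occ c w).
Proof. by apply: sorted_filter (iota_ltn_sorted _ _); exact: ltn_trans. Qed.

Lemma rk_lt c w i : nth None w i = Some c -> rk c w i < size (occ c w).
Proof. by move=> h; rewrite size_occ; apply: ltn_rk (letter_size _ _ _ h) h. Qed.

Lemma occ_rk c w i : nth None w i = Some c -> nth 0 (occ c w) (rk c w i) = i.
Proof.
move=> h; have hi := letter_size _ _ _ h.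
rewrite /occ -[size w](subnKC (ltnW hi)) iotaD filter_cat nth_cat.
rewrite size_filter_iota ltnn subnn.
by case: (size w - i) (subn_gt0 i (size w)) => [|m] /=; [rewrite hi | rewrite add0n h eqxx].
Qed.

Lemma letter_occ c w r : r < size (occ c w) -> nth None w (nth 0 (occ c w) r) = Some c.
Proof. by move=> h; apply/eqP; rewrite -mem_occ mem_nth. Qed.

Lemma rk_occ c w r : r < size (occ c w) -> rk c w (nth 0 (occ c w) r) = r.
Proof.
move=> h; have l := letter_occ _ _ _ h.
by apply/eqP; rewrite -(nth_uniq 0 (rk_lt _ _ _ l) h (occ_uniq c w)) occ_rk.
Qed.

Lemma ltn_occ_rk c w r i : r < size (occ c w) -> (nth 0 (occ c w) r < i) = (r < rk c w i).
Proof.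
move=> h; case: ltnP => hi; apply/esym.
  by rewrite -{1}(rk_occ _ _ _ h) ltn_rk // letter_occ.
by apply/negbTE; rewrite -leqNgt -[leqRHS](rk_occ _ _ _ h) leq_rk.
Qed.

Lemma ltn_occ c w r s : r < size (occ c w) -> s < size (occ c w) ->
  (nth 0 (occ c w) r < nth 0 (occ c w) s) = (r < s).
Proof. by move=> hr hs; rewrite ltn_occ_rk // rk_occ. Qed.

(* [e] flags the ends of blocks; [i] letters a and [j] letters b have been read. *)
Fixpoint word_ok (e : seq bool) (i j : nat) (w : seq letter) : bool :=
  match w with
  | [::] => (i == size e) && (j == size e)
  | Some true :: t =>
      [&& i < size e, nth false e i || (head None t == Some true) & word_ok e i.+1 j t]
  | Some false :: t =>
      [&& j < size e, nth false e j || (head None t == Some false) & word_ok e i j.+1 t]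
  | None :: t => (i == j) && word_ok e i j t
  end.

Definition good_at (e : seq bool) (i j : nat) (w : seq letter) (x : nat) : bool :=
  match nth None w x with
  | Some true => nth false e (i + rk true w x) || (nth None w x.+1 == Some true)
  | Some false => nth false e (j + rk false w x) || (nth None w x.+1 == Some false)
  | None => i + rk true w x == j + rk false w x
  end.

Lemma word_okP e i j w :
  reflect [/\ i + rk true w (size w) = size e,
              j + rk false w (size w) = size e
            & forall x, x < size w -> good_at e i j w x]
          (word_ok e i j w).
Proof.
elim: w i j => [|l t IH] i j.
  by rewrite /= !rk0 !addn0; apply: (iffP andP); [case=> /eqP-> /eqP-> | case=> -> ->].
have step i' j' : (i' = i + (l == Some true)) -> (j' = j + (l == Some false)) ->
    forall x, good_at e i j (l :: t) x.+1 = good_at e i' j' t x.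
  by move=> -> -> x; rewrite /good_at /= !rk_cons !addnA.
rewrite [size _]/= !rk_cons; case: l step => [[]|] step;
  rewrite /= ?eqxx ?add0n ?addn0 ?addn1 ?add1n in step *.
- apply: (iffP and3P) => [[h1 h2 /IH [h3 h4 h5]]|[h1 h2 h3]].
    split; [lia | lia |] => -[_|x hx]; first by rewrite /good_at /= rk0 addn0 nth0.
    by rewrite (step i.+1 j) ?addn1 ?addn0 //; apply: h5.
  split; [lia | by have := h3 0 isT; rewrite /good_at /= rk0 addn0 nth0 |].
  apply/IH; split; [lia | lia |] => x hx.
  by rewrite -(step i.+1 j) ?addn1 ?addn0 //; apply: h3.
- apply: (iffP and3P) => [[h1 h2 /IH [h3 h4 h5]]|[h1 h2 h3]].
    split; [lia | lia |] => -[_|x hx]; first by rewrite /good_at /= rk0 addn0 nth0.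
    by rewrite (step i j.+1) ?addn1 ?addn0 //; apply: h5.
  split; [lia | by have := h3 0 isT; rewrite /good_at /= rk0 addn0 nth0 |].
  apply/IH; split; [lia | lia |] => x hx.
  by rewrite -(step i j.+1) ?addn1 ?addn0 //; apply: h3.
- apply: (iffP andP) => [[/eqP h1 /IH [h3 h4 h5]]|[h1 h2 h3]].
    split; [lia | lia |] => -[_|x hx]; first by rewrite /good_at /= !rk0 h1.
    by rewrite (step i j) ?addn0 //; apply: h5.
  split; first by have := h3 0 isT; rewrite /good_at /= !rk0 !addn0.
  apply/IH; split; [lia | lia |] => x hx.
  by rewrite -(step i j) ?addn0 //; apply: h3.
Qed.

Definition av132 (t : seq nat) : Prop :=
  forall i j l, i < j -> j < l -> l < size t ->
    ~ (nth 0 t i < nth 0 t l /\ nth 0 t l < nth 0 t j).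

Fixpoint rlmax (t : seq nat) : seq bool :=
  if t is x :: t' then all (fun y => y < x) t' :: rlmax t' else [::].

Lemma size_rlmax t : size (rlmax t) = size t.
Proof. by elim: t => //= x t ->. Qed.

Lemma nth_rlmax t i : i < size t ->
  nth false (rlmax t) i = all (fun y => y < nth 0 t i) (drop i.+1 t).
Proof. by elim: t i => //= x t IH [|i] h /=; rewrite ?drop0 // IH. Qed.

Lemma rlmaxPn t i j : i < j -> j < size t -> nth 0 t i < nth 0 t j ->
  nth false (rlmax t) i = false.
Proof.
move=> ij jt h; rewrite nth_rlmax; last lia.
apply/negbTE/allPn; exists (nth 0 t j); last by rewrite -leqNgt ltnW.
have -> : nth 0 t j = nth 0 (drop i.+1 t) (j - i.+1) by rewrite nth_drop subnKC.
by apply: mem_nth; rewrite size_drop; rewrite ltn_sub2r ?(leq_trans _ jt).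
Qed.

Lemma rlmaxN t i : i < size t -> uniq t -> nth false (rlmax t) i = false ->
  exists j, [/\ i < j, j < size t & nth 0 t i < nth 0 t j].
Proof.
move=> it ut; rewrite nth_rlmax // => /negbT /allPn [y].
move=> /(nthP 0) [m]; rewrite size_drop nth_drop => hm <-; rewrite -leqNgt => h.
have hj : i.+1 + m < size t by rewrite -ltn_subRL.
exists (i.+1 + m); split=> //; first by rewrite addSn ltnS leq_addr.
by rewrite ltn_neqAle h andbT nth_uniq // neq_ltn addSn ltnS leq_addr.
Qed.

End Words.

Section Decode.
Local Open Scope nat_scope.

(* Positions and values start at 0, so position [k + i] carries letter [i] of [w]. *)
Definition decode (t : seq nat) (w : seq letter) (x : nat) : nat :=
  let k := size t in
  if x < k then k + nth 0 (occ true w) (index x t)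
  else match nth None w (x - k) with
       | Some true => k + nth 0 (occ false w) (rk true w (x - k))
       | Some false => nth 0 t (rk false w (x - k))
       | None => x
       end.

Definition code_ok (n : nat) (t : seq nat) (w : seq letter) : Prop :=
  [/\ perm_eq t (iota 0 (size t)), av132 t, size t + size w = n
    & word_ok (rlmax t) 0 0 w].

Definition av132f (n : nat) (g : nat -> nat) : Prop :=
  forall x y z, x < y -> y < z -> z < n -> ~ (g x < g z /\ g z < g y).

Section CodeOk.
Variables (n : nat) (t : seq nat) (w : seq letter).
Hypothesis cok : code_ok n t w.
Let k := size t.
Let P c := occ c w.
Let g := decode t w.

Lemma code_uniq : uniq t.
Proof. by case: cok => h _ _ _; rewrite (perm_uniq h) iota_uniq. Qed.

Lemma code_mem x : (x \in t) = (x < k).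
Proof. by case: cok => h _ _ _; rewrite (perm_mem h) mem_iota. Qed.

Lemma code_lt r : r < k -> nth 0 t r < k.
Proof. by move=> h; rewrite -code_mem mem_nth. Qed.

Lemma code_size c : size (P c) = k.
Proof.
case: cok => _ _ _ /word_okP [h1 h2 _].
by rewrite size_occ -[RHS](size_rlmax t); case: c; [rewrite -h1 | rewrite -h2].
Qed.

Lemma code_none i : i < size w -> nth None w i = None -> rk true w i = rk false w i.
Proof.
case: cok => _ _ _ /word_okP [_ _ h] /h; rewrite /good_at => + e.
by rewrite e => /eqP.
Qed.

Lemma code_next c i : nth None w i = Some c ->
  nth false (rlmax t) (rk c w i) = false -> nth None w i.+1 = Some c.
Proof.
case: cok => _ _ _ /word_okP [_ _ h] e; move: (h i (letter_size _ _ _ e)).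
rewrite /good_at e; case: c e => e + e2; rewrite !add0n e2 /=; exact: eqP.
Qed.

Lemma decode_lo r : r < k -> g (nth 0 t r) = k + nth 0 (P true) r.
Proof. by move=> h; rewrite /g /decode code_lt // index_uniq // code_uniq. Qed.

Lemma decode_a r : r < k -> g (k + nth 0 (P true) r) = k + nth 0 (P false) r.
Proof.
move=> h; rewrite /g /decode -/k ltnNge leq_addr /= addKn letter_occ ?rk_occ //;
by rewrite code_size.
Qed.

Lemma decode_b r : r < k -> g (k + nth 0 (P false) r) = nth 0 t r.
Proof.
move=> h; rewrite /g /decode -/k ltnNge leq_addr /= addKn letter_occ ?rk_occ //;
by rewrite code_size.
Qed.

Lemma decode_f i : nth None w i = None -> g (k + i) = k + i.
Proof. by move=> h; rewrite /g /decode -/k ltnNge leq_addr /= addKn h. Qed.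

Variant code_spec : nat -> Prop :=
  | CodeLo r of r < k : code_spec (nth 0 t r)
  | CodePos c r of r < k : code_spec (k + nth 0 (P c) r)
  | CodeFix i of nth None w i = None & i < size w : code_spec (k + i).

Lemma codeP x : x < n -> code_spec x.
Proof.
have [_ _ hn _] := cok => hx; case: (ltnP x k) => h.
  have xt : x \in t by rewrite code_mem.
  rewrite -(nth_index 0 xt).
  by apply: CodeLo; rewrite index_mem code_mem.
rewrite -(subnKC h); case e: (nth None w (x - k)) => [c|].
  rewrite -(occ_rk _ _ _ e); apply: CodePos.
  by have := rk_lt _ _ _ e; rewrite code_size.
by apply: CodeFix => //; rewrite /k in h *; lia.
Qed.

Lemma occ_lt c r : r < k -> nth 0 (P c) r < size w.
Proof. by move=> h; apply: (@letter_size c); rewrite letter_occ // code_size. Qed.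

Lemma decode_lt x : x < n -> g x < n.
Proof.
move=> /codeP; have [_ _ hn _] := cok; rewrite -hn -/k.
case=> [r h|[] r h|i h hi].
- by rewrite decode_lo // ltn_add2l occ_lt.
- by rewrite decode_a // ltn_add2l occ_lt.
- by rewrite decode_b // ltn_addr // code_lt.
- by rewrite decode_f // ltn_add2l.
Qed.

Lemma decode3 x : x < n -> g (g (g x)) = x.
Proof.
move=> /codeP [r h|[] r h|i h hi].
- by rewrite decode_lo // decode_a // decode_b.
- by rewrite decode_a // decode_b // decode_lo.
- by rewrite decode_b // decode_lo // decode_a.
- by rewrite !decode_f.
Qed.

Lemma decode_ge x : x < k -> exists2 r, r < k & nth 0 t r = x /\ g x = k + nth 0 (P true) r.
Proof.
rewrite -code_mem => h; exists (index x t); first by rewrite index_mem.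
by split; [rewrite nth_index | rewrite -decode_lo ?nth_index // index_mem].
Qed.

Lemma decode_incr x y : k <= x -> x < y -> y < n -> k <= g x -> k <= g y -> g x < g y.
Proof.
move=> kx xy yn; have xn : x < n by lia.
have lo r : r < k -> k <= nth 0 t r -> False by move=> /code_lt; lia.
move: xy; case: (codeP y yn) => [r h|c r h|j e hj].
- by move=> xy; have := code_lt _ h; lia.
- case: c; last by move=> _ _; rewrite decode_b // => /(lo _ h).
  move: kx; case: (codeP x xn) => [s hs /(lo _ hs)//|[] s hs _|i e hi _].
  + rewrite ltn_add2l ltn_occ ?code_size // !decode_a // ltn_add2l => + _ _.
    by rewrite ltn_occ ?code_size.
  + by move=> _; rewrite decode_b // => /(lo _ hs).
  + rewrite decode_f // decode_a // !ltn_add2l => + _ _.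
    apply: contraTT; rewrite -!leqNgt => h1; apply: ltnW.
    have : nth 0 (P false) r < i.
      rewrite ltn_neqAle h1 andbT; apply/eqP => e2.
      by move: e; rewrite -e2 letter_occ // code_size.
    by rewrite !ltn_occ_rk ?code_size // code_none.
- move: kx; case: (codeP x xn) => [s hs /(lo _ hs)//|[] s hs _|i e2 hi _].
  + rewrite decode_a // decode_f // !ltn_add2l => + _ _.
    by rewrite !ltn_occ_rk ?code_size // code_none.
  + by move=> _; rewrite decode_b // => /(lo _ hs).
  + by rewrite !decode_f.
Qed.

(* Since [t] avoids 132, no entry from [t_r] up to (excluding) [t_s] is a
   right-to-left maximum when [t_r < t_s]. *)
Lemma code_contig c r s i : r < s -> s < k -> nth 0 t r < nth 0 t s ->
  nth 0 (P c) r <= i -> i <= nth 0 (P c) s -> nth None w i = Some c.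
Proof.
move=> rs sk hrs ri; have rk' : r < k by lia.
rewrite -(subnKC ri); elim: (i - _) => [|d IH] hd.
  by rewrite addn0 letter_occ // code_size.
have e := IH (leq_trans (leq_addr 1 _) _).
rewrite addn1 -addnS in e; have {}e := e hd.
rewrite addnS; apply: code_next => //.
set j := _ + d in e *.
have hj : j < nth 0 (P c) s by rewrite /j; lia.
have jr : r <= rk c w j.
  by rewrite -{1}(rk_occ c w r) ?code_size // leq_rk // /j leq_addr.
have js : rk c w j < s.
  by rewrite -[ltnRHS](rk_occ c w s) ?code_size // ltn_rk.
apply: (@rlmaxPn _ _ s) => //.
case: (ltnP (nth 0 t (rk c w j)) (nth 0 t s)) => // h.
have ne : nth 0 t (rk c w j) != nth 0 t s.
  by rewrite nth_uniq ?code_uniq ?(ltn_trans js sk) // neq_ltn js.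
have jr' : r < rk c w j.
  by rewrite ltn_neqAle jr andbT; apply/eqP => e2; move: h; rewrite -e2; lia.
by case: cok => _ av _ _; case: (av r (rk c w j) s) => //; split => //; lia.
Qed.

Lemma decode_av : av132f n g.
Proof.
move=> x y z xy yz zn [h1 h2]; have [_ av _ _] := cok.
have yn : y < n by lia.
have incr := @decode_incr y z.
case: (ltnP x k) => xk.
  have [r hr [e1 e2]] := decode_ge _ xk.
  case: (ltnP y k) => yk; last by have := incr yk yz zn; lia.
  have [s hs [e3 e4]] := decode_ge _ yk.
  have rs : r < s by rewrite -(@ltn_occ true w) ?code_size // -/(P true); lia.
  case: (ltnP z k) => zk.
    have [q hq [e5 e6]] := decode_ge _ zk.
    have rq : r < q by rewrite -(@ltn_occ true w) ?code_size // -/(P true); lia.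
    have qs : q < s by rewrite -(@ltn_occ true w) ?code_size // -/(P true); lia.
    by apply: (av r q s) => //; rewrite e1 e3 e5.
  have ha : nth None w (g z - k) = Some true.
    by apply: (@code_contig _ r s); rewrite ?e1 ?e3 //; lia.
  case: (codeP z zn) zk h1 h2 ha => [q hq|[] q hq|i e hi].
  + by have := code_lt _ hq; lia.
  + by rewrite decode_a // addKn letter_occ // code_size.
  + by rewrite decode_b //; have := code_lt _ hq; lia.
  + by rewrite decode_f // addKn e.
have yk : k <= y by lia.
case: (ltnP (g z) k) => gz; last by have := incr yk yz zn; lia.
have xn : x < n by lia.
case: (codeP x xn) xk h1 xy => [r hr|[] r hr|i e hi].
- by have := code_lt _ hr; lia.
- by rewrite decode_a //; lia.
- move=> _; rewrite decode_b // => hrz ry.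
  case: (codeP z zn) yz gz h2 hrz => [q hq|[] q hq|i e hi].
  + by have := code_lt _ hq; lia.
  + by rewrite decode_a //; lia.
  + rewrite decode_b // => yq _ qy rq.
    have rq' : r < q by rewrite -(@ltn_occ false w) ?code_size // -/(P false); lia.
    case: (codeP y yn) yk ry yq qy => [s hs|[] s hs|i e hi].
    * by have := code_lt _ hs; lia.
    * move=> _; rewrite !ltn_add2l => ry yq _.
      have := @code_contig false r q _ rq' hq rq (ltnW ry) (ltnW yq).
      by rewrite letter_occ ?code_size.
    * move=> _; rewrite !ltn_add2l decode_b // !ltn_occ ?code_size // => rs sq h.
      by apply: (av r s q) => //; split => //; lia.
    * move=> _; rewrite !ltn_add2l => ry yq _.
      by have := @code_contig false r q i rq' hq rq (ltnW ry) (ltnW yq); rewrite e.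
  + by rewrite decode_f //; lia.
- by rewrite decode_f //; lia.
Qed.

End CodeOk.

Lemma decode_size_le n t w t' w' : code_ok n t w -> code_ok n t' w' ->
  (forall x, x < n -> decode t w x = decode t' w' x) -> size t' <= size t.
Proof.
move=> c1 c2 h; rewrite leqNgt; apply/negP => lt.
have [_ _ hn _] := c1; have [_ _ hn' _] := c2.
have lo x : x < size t' -> size t' <= decode t w x.
  move=> xt; rewrite h; last lia.
  by have [r _ [_ ->]] := decode_ge _ _ _ c2 _ xt; rewrite leq_addr.
have kn : size t < n by lia.
suff bad x : x < n -> x = size t -> False by apply: bad kn _.
move=> /(codeP _ _ _ c1) [r hr|[] r hr|i e hi] ex.
- by have := code_lt _ _ _ c1 _ hr; lia.
- have := lo (nth 0 t r); rewrite (decode_lo _ _ _ c1) //.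
  by have := code_lt _ _ _ c1 _ hr; lia.
- have := lo (size t) lt; rewrite -ex (decode_b _ _ _ c1) //.
  by have := code_lt _ _ _ c1 _ hr; lia.
- by have := lo (size t) lt; rewrite -ex decode_f //; lia.
Qed.

Lemma decode_inj n t w t' w' : code_ok n t w -> code_ok n t' w' ->
  (forall x, x < n -> decode t w x = decode t' w' x) -> t = t' /\ w = w'.
Proof.
move=> c1 c2 h; have [_ _ hn _] := c1; have [_ _ hn' _] := c2.
have st : size t = size t'.
  apply/eqP; rewrite eqn_leq (decode_size_le _ _ _ _ _ c1 c2 h) andbT.
  by apply: decode_size_le c2 c1 _ => x hx; rewrite h.
have letterE u v i : code_ok n u v -> i < size v ->
    nth None v i = if decode u v (size u + i) < size u then Some false
                   else if decode u v (size u + i) == size u + i then None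
                   else Some true.
  move=> c hi; case e: (nth None v i) => [b|].
    have hr : rk b v i < size u by rewrite -(code_size _ _ _ c b) rk_lt.
    rewrite -(occ_rk _ _ _ e); case: b e hr => e hr; last first.
      by rewrite (decode_b _ _ _ c) // (code_lt _ _ _ c).
    rewrite (decode_a _ _ _ c) // ltnNge leq_addr eqn_add2l /=; case: eqP => // e2.
    have := letter_occ false v (rk true v i); rewrite (code_size _ _ _ c).
    by rewrite e2 occ_rk // e => /(_ hr).
  by rewrite decode_f // eqxx ltnNge leq_addr.
have sw : size w = size w' by apply/eqP; rewrite -(eqn_add2l (size t)) hn st hn'.
have ww : w = w'.
  apply: (@eq_from_nth _ None) => // i hi; have hi' : i < size w' by rewrite -sw.
  by rewrite (letterE t) // (letterE t') // -st h // -hn ltn_add2l.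
split=> //; subst w'; apply: (@eq_from_nth _ 0) => // r hr.
have hr' : r < size t' by rewrite -st.
rewrite -(decode_b _ _ _ c1) // -(decode_b _ _ _ c2) // -st h //.
by rewrite -hn ltn_add2l (occ_lt _ _ _ c1).
Qed.

End Decode.

Section Encode.
Local Open Scope nat_scope.
Variables (n : nat) (p : nat -> nat).
Hypothesis p_lt : forall x, x < n -> p x < n.
Hypothesis p3 : forall x, x < n -> p (p (p x)) = x.
Hypothesis p_av : av132f n p.

Lemma p_inj x y : x < n -> y < n -> p x = p y -> x = y.
Proof. by move=> hx hy e; rewrite -(p3 x hx) e p3. Qed.

Lemma split_exists : exists k, [/\ k <= n, forall i, i < k -> k <= p i
  & forall u v, k <= u -> u < v -> v < n -> k <= p u -> k <= p v -> p u < p v].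
Proof.
pose P k := (k <= n) && all (fun i => k <= p i) (iota 0 k).
have P0 : exists k, P k by exists 0.
have Pn k : P k -> k <= n by case/andP.
case: (ex_maxnP P0 Pn) => k /andP [kn /allP hk] kmax; exists k.
have lo i : i < k -> k <= p i by move=> hi; apply: hk; rewrite mem_iota.
split=> // u v ku uv vn hu hv.
have un : u < n by lia.
case: (ltngtP (p u) (p v)) => // h; last by have := p_inj _ _ un vn h; lia.
have : ~~ P k.+1 by apply/negP => /kmax; rewrite ltnn.
have kn' : k < n by lia.
rewrite negb_and kn' orFb => /allPn [i]; rewrite mem_iota /= add0n ltnS -leqNgt => ik iS.
have [ik'|ki] := ltnP i k.
  have e : p i = k by have := lo _ ik'; lia.
  have ne : p v <> k by move=> e2; have := p_inj i v _ vn; rewrite e e2 => /(_ _ erefl); lia.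
  by exfalso; apply: (p_av i u v) => //; [lia | split; lia].
have e : i = k by lia.
rewrite {i ik ki}e in iS.
have uk : u <> k by move=> e; rewrite e in h hu; lia.
have ne : p v <> p k by move=> e2; have := p_inj v k vn _ e2; lia.
by exfalso; apply: (p_av k u v) => //; [lia | split; lia].
Qed.

Section Split.
Variable k : nat.
Hypothesis kn : k <= n.
Hypothesis lo : forall i, i < k -> k <= p i.
Hypothesis incr : forall u v,
  k <= u -> u < v -> v < n -> k <= p u -> k <= p v -> p u < p v.

Definition letter_of (x : nat) : letter :=
  if p x < k then Some false else if p x == x then None else Some true.

Definition word_of : seq letter := [seq letter_of (k + i) | i <- iota 0 (n - k)].

Let w := word_of.
Let t := [seq p (k + i) | i <- occ false w].

Lemma size_word : size w = n - k.
Proof. by rewrite size_map size_iota. Qed.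

Lemma nth_word i : i < n - k -> nth None w i = letter_of (k + i).
Proof. by move=> h; rewrite (nth_map 0) ?size_iota // nth_iota. Qed.

Lemma word_letter i c : nth None w i = Some c -> i < n - k /\ letter_of (k + i) = Some c.
Proof.
move=> h; have := letter_size _ _ _ h; rewrite size_word => hi.
by rewrite -nth_word.
Qed.

Lemma letter_b x : letter_of x = Some false <-> p x < k.
Proof. by rewrite /letter_of; case: ltnP => //; case: eqP. Qed.

Lemma letter_a x : k <= x -> x < n -> letter_of x = Some true <-> p (p x) < k.
Proof.
move=> kx xn; rewrite /letter_of; have x1 := p_lt _ xn; have x2 := p_lt _ x1.
case: ltnP => h1; first by split=> //; have := lo _ h1; lia.
case: eqP => h2; first by rewrite h2; split=> //; lia.
split=> // _; rewrite ltnNge; apply/negP => h3.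
have x3 := p3 _ xn.
case: (ltngtP x (p x)) => [lt|lt|e]; last by rewrite -e in h2.
  have l2 := incr _ _ kx lt x1 h1 h3.
  by have := incr _ _ h1 l2 x2 h3; rewrite x3 => /(_ kx); lia.
have l2 := incr _ _ h1 lt xn h3 h1.
by have := incr _ _ h3 l2 x1; rewrite x3 => /(_ kx h3); lia.
Qed.

Lemma mem_word_b i : (i \in occ false w) = (i < n - k) && (p (k + i) < k).
Proof.
rewrite mem_occ; apply/eqP/andP => [/word_letter [h1 /letter_b h2]//|[h1 h2]].
by rewrite nth_word //; apply/letter_b.
Qed.

Lemma mem_word_a i : (i \in occ true w) = (i < n - k) && (p (p (k + i)) < k).
Proof.
rewrite mem_occ; apply/eqP/andP => [/word_letter [h1 h2]|[h1 h2]].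
  by split=> //; apply/letter_a => //; lia.
by rewrite nth_word //; apply/letter_a => //; lia.
Qed.

Lemma word_a_lt i : i \in occ true w -> k + i < n /\ k <= p (k + i).
Proof.
rewrite mem_word_a => /andP [h1 h2]; split; first lia.
rewrite leqNgt; apply/negP => h; have := lo _ h; lia.
Qed.

Lemma occ_false_word :
  [seq k + i | i <- occ false w] = [seq p (k + i) | i <- occ true w].
Proof.
apply: (irr_sorted_eq ltn_trans ltnn).
- rewrite sorted_map; apply: sub_sorted (occ_sorted _ _) => x y /=.
  by rewrite ltn_add2l.
- rewrite sorted_map; apply: (@sub_in_sorted _ (mem (occ true w)) ltn) (occ_sorted _ _).
    move=> x y hx hy /= xy.
    have [x1 x2] := word_a_lt _ hx; have [y1 y2] := word_a_lt _ hy.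
    by apply: incr => //; lia.
  by apply/allP.
move=> y; apply/mapP/mapP => -[i hi ->].
  move: hi; rewrite mem_word_b => /andP [h1 h2].
  have hn : k + i < n by lia.
  exists (p (p (k + i)) - k); last by rewrite subnKC ?p3 // lo.
  rewrite mem_word_a subnKC ?lo // (p3 _ hn) h2 andbT.
  by rewrite ltn_sub2r ?p_lt ?p_lt //; lia.
have [h1 h2] := word_a_lt _ hi; move: hi; rewrite mem_word_a => /andP [h3 h4].
exists (p (k + i) - k); last by rewrite subnKC.
by rewrite mem_word_b subnKC // h4 andbT ltn_sub2r ?p_lt //; lia.
Qed.

Lemma size_occ_word c : size (occ c w) = k.
Proof.
have mt : t =i iota 0 k.
  move=> x; rewrite mem_iota /= add0n; apply/mapP/idP => [[i]|hx].
    by rewrite mem_word_b => /andP [_ h] ->.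
  have x0 : x < n by lia.
  have x1 := p_lt _ x0; have x2 := p_lt _ x1; have kx := lo _ hx.
  have k2 : k <= p (p x).
    by rewrite leqNgt; apply/negP => h; have := lo _ h; rewrite p3 //; lia.
  exists (p (p x) - k); last by rewrite subnKC ?p3.
  by rewrite mem_word_b subnKC // p3 // hx andbT ltn_sub2r //; lia.
have ut : uniq t.
  rewrite map_inj_in_uniq ?occ_uniq // => i j.
  rewrite !mem_word_b => /andP [hi _] /andP [hj _] /p_inj e.
  by apply: (@addnI k); apply: e; lia.
have sf : size (occ false w) = k.
  by rewrite -(size_iota 0 k) -(perm_size (uniq_perm ut (iota_uniq _ _) mt)) size_map.
case: c => //; rewrite -[RHS]sf.
by have := congr1 size occ_false_word; rewrite !size_map.
Qed.

Lemma size_t : size t = k.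
Proof. by rewrite size_map size_occ_word. Qed.

Let A r := k + nth 0 (occ true w) r.
Let B r := k + nth 0 (occ false w) r.

Lemma occ_word_lt c r : r < k -> nth 0 (occ c w) r < n - k.
Proof.
by move=> h; rewrite -size_word; apply: (@letter_size c); rewrite letter_occ // size_occ_word.
Qed.

Lemma pA r : r < k -> p (A r) = B r.
Proof.
move=> h; have := congr1 (nth 0 ^~ r) occ_false_word.
by rewrite /= !(nth_map 0) ?size_occ_word.
Qed.

Lemma pB r : r < k -> p (B r) = nth 0 t r.
Proof. by move=> h; rewrite (nth_map 0) ?size_occ_word. Qed.

Lemma A_lt r : r < k -> A r < n.
Proof. by move=> /(occ_word_lt true); rewrite /A; lia. Qed.

Lemma B_lt r : r < k -> B r < n.
Proof. by move=> /(occ_word_lt false); rewrite /B; lia. Qed.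

Lemma pt r : r < k -> p (nth 0 t r) = A r.
Proof. by move=> h; rewrite -pB // -pA // p3 // A_lt. Qed.

Lemma t_lt r : r < k -> nth 0 t r < k.
Proof.
move=> h; rewrite -pB //.
have : nth 0 (occ false w) r \in occ false w by rewrite mem_nth // size_occ_word.
by rewrite mem_word_b => /andP [].
Qed.

Lemma perm_t : perm_eq t (iota 0 (size t)).
Proof.
rewrite size_t; have ut : uniq t.
  rewrite map_inj_in_uniq ?occ_uniq // => i j.
  rewrite !mem_word_b => /andP [hi _] /andP [hj _] /p_inj e.
  by apply: (@addnI k); apply: e; lia.
apply: uniq_perm (iota_uniq _ _) _ => //.
apply: (uniq_min_size ut _ _).2; last by rewrite size_iota size_t.
by move=> x /(nthP 0) [r]; rewrite size_t => hr <-; rewrite mem_iota /= t_lt.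
Qed.

Lemma B_mono r s : r < s -> s < k -> B r < B s.
Proof. by move=> rs sk; rewrite ltn_add2l ltn_occ ?size_occ_word //; lia. Qed.

Lemma rk_word c i : nth None w i = Some c -> rk c w i < k.
Proof. by move=> h; rewrite -(size_occ_word c) rk_lt. Qed.

Lemma code_ok_word : code_ok n t w.
Proof.
have [ut tav] : uniq t /\ av132 t.
  split; first by rewrite (perm_uniq perm_t) iota_uniq.
  move=> i j l ij jl; rewrite size_t => lk [h1 h2].
  apply: (p_av (B i) (B j) (B l)); rewrite ?B_mono ?B_lt ?pB //; lia.
split=> //; first exact: perm_t.
  by rewrite size_t size_word subnKC.
apply/word_okP; split; rewrite ?add0n -?size_occ ?size_occ_word ?size_rlmax ?size_t //.
move=> x; rewrite size_word /good_at !add0n => hx.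
case e: (nth None w x) => [c|].
  have [r rE] : exists r, r = rk c w x by eexists.
  have hr : r < k by rewrite rE rk_word.
  have er : nth 0 (occ c w) r = x by rewrite rE occ_rk.
  suff H : nth false (rlmax t) r || (nth None w x.+1 == Some c).
    by move: rE H; case: (c) => <-.
  case: (boolP (nth false (rlmax t) r)) => //= /negbTE hn; apply/negPn/negP => /eqP ne.
  have [||s [rs]] := rlmaxN t r _ _ hn => //; first by rewrite size_t.
  rewrite size_t => sk hrs.
  have xs : x.+1 < nth 0 (occ c w) s.
    rewrite ltn_neqAle -{2}er ltn_occ ?size_occ_word // rs andbT; apply/eqP => e2.
    by apply: ne; rewrite e2 letter_occ // size_occ_word.
  have hsn := occ_word_lt c s sk.
  have hx1 : x.+1 < n - k by lia.
  rewrite nth_word // in ne.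
  have x1 := p_lt (k + x.+1) ltac:(lia).
  case: c e rE er ne xs hsn => e rE er ne xs hsn.
    have hge : k <= p (p (k + x.+1)).
      by rewrite leqNgt; apply/negP => h; apply: ne; apply/letter_a => //; lia.
    apply: (p_av (nth 0 t r) (nth 0 t s) (p (p (k + x.+1)))) => //.
    + by have := t_lt s sk; lia.
    + exact: p_lt.
    + by rewrite p3 ?pt // /A ?er; lia.
  have hge : k <= p (k + x.+1).
    by rewrite leqNgt; apply/negP => h; apply: ne; apply/letter_b.
  apply: (p_av (B r) (k + x.+1) (B s)).
  + by rewrite /B er; lia.
  + by rewrite /B; lia.
  + exact: B_lt.
  + by rewrite !pB //; have := t_lt s sk; lia.
have fx : p (k + x) = k + x.
  by move: e; rewrite nth_word // /letter_of; case: ltnP => // _; case: eqP.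
have AB r : r < k -> (A r < k + x) = (B r < k + x).
  move=> hr; have hA := A_lt _ hr.
  have nA : A r <> k + x.
    move=> /addnI e2; by move: e; rewrite -e2 letter_occ // size_occ_word.
  case: (ltngtP (A r) (k + x)) => // h; apply/esym.
    by rewrite -pA // -{1}fx; apply: incr => //; rewrite ?pA /A /B //; lia.
  apply/negbTE; rewrite -leqNgt ltnW // -pA // -{1}fx.
  by apply: incr => //; rewrite ?pA /A /B //; lia.
have rle c : rk c w x <= k.
  by rewrite -(size_occ_word c) size_occ leq_rk // size_word ltnW.
have key r : r < k -> (r < rk true w x) = (r < rk false w x).
  move=> hr; have := AB _ hr; rewrite !ltn_add2l !ltn_occ_rk ?size_occ_word //.
have r1 := rle true; have r2 := rle false.
case: (ltngtP (rk true w x) (rk false w x)) => // h.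
  by have := key (rk true w x); rewrite ltnn h; lia.
by have := key (rk false w x); rewrite ltnn h; lia.
Qed.

Lemma decode_word x : x < n -> decode t w x = p x.
Proof.
have c := code_ok_word => /(codeP _ _ _ c).
case=> [r|[] r|i e hi]; only 1-3: (rewrite {1}size_t => hr).
- by rewrite (decode_lo _ _ _ c) size_t // pt.
- by rewrite (decode_a _ _ _ c) size_t // -/(B r) -pA.
- by rewrite (decode_b _ _ _ c) ?size_t // -/(B r) pB.
rewrite decode_f // size_t.
move: hi; rewrite size_word => hi; move: e; rewrite nth_word // /letter_of.
by case: ltnP => // _; case: eqP.
Qed.

End Split.

Lemma encode_exists : exists t w, code_ok n t w /\ forall x, x < n -> decode t w x = p x.
Proof.
have [k [kn lo incr]] := split_exists.
by eexists; eexists; split; [exact: code_ok_word kn lo incr | exact: decode_word kn lo incr].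
Qed.

End Encode.

Section WordCount.
Local Open Scope nat_scope.

Fixpoint all_words (N : nat) : seq (seq letter) :=
  if N is N'.+1 then
    map (cons (Some true)) (all_words N') ++ map (cons (Some false)) (all_words N')
      ++ map (cons None) (all_words N')
  else [:: [::]].

Lemma mem_all_words N w : (w \in all_words N) = (size w == N).
Proof.
have cm l (s : seq (seq letter)) v : (v \in map (cons l) s) = (ohead v == Some l) && (behead v \in s).
  apply/mapP/andP => [[u us ->]|[]]; first by rewrite /= eqxx.
  by case: v => //= x v /eqP [->] vs; exists v.
elim: N w => [|N IH] [|l w] //=; rewrite !mem_cat !cm /= //.
by rewrite !IH; case: l => [[]|] /=; rewrite ?orbF.
Qed.

Lemma all_words_uniq N : uniq (all_words N).
Proof.
have dis l l' (s : seq (seq letter)) : l != l' -> has (mem (map (cons l) s)) (map (cons l') s) = false.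
  move=> ne; apply/negbTE/hasPn => v /mapP [u _ ->]; apply/negP => /mapP [u' _ [e _]].
  by rewrite e eqxx in ne.
have inj l : injective (cons l : seq letter -> _) by move=> u v [].
elim: N => //= N IH; rewrite !cat_uniq has_cat !dis //= !map_inj_uniq ?IH //.
Qed.

(* Words of length [N] with [p] a-blocks and [q] b-blocks contracted to letters;
   the other [N - p - q] letters are f. *)
Fixpoint block_words (N p q : nat) : nat :=
  if N is N'.+1 then
    (if p is p'.+1 then block_words N' p' q else 0) + (if q is q'.+1 then block_words N' p q' else 0)
      + (if p == q then block_words N' p q else 0)
  else ((p == 0) && (q == 0) : nat).

Lemma block_words_small N p q : N < p + q -> block_words N p q = 0.
Proof.
elim: N p q => [|N IH] p q /=; first by case: p => [|p]; case: q.
by case: p => [|p]; case: q => [|q] // h; rewrite ?IH ?if_same //; lia.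
Qed.

Lemma block_words_sym N p q : block_words N p q = block_words N q p.
Proof.
elim: N p q => [|N IH] p q /=; first by rewrite andbC.
rewrite [q == p]eq_sym [block_words N q p]IH; congr (_ + _); rewrite addnC.
by congr (_ + _); [case: q | case: p] => // m; rewrite IH.
Qed.

Lemma block_words_bound N p q : block_words N p q <= expn 3 N.
Proof.
elim: N p q => [|N IH] p q; rewrite [block_words _ _ _]/=; first by case: (_ && _).
have h1 : (if p is p'.+1 then block_words N p' q else 0) <= expn 3 N by case: (p).
have h2 : (if q is q'.+1 then block_words N p q' else 0) <= expn 3 N by case: (q).
have h3 : (if p == q then block_words N p q else 0) <= expn 3 N by case: (p == q).
by rewrite expnS; lia.
Qed.

Section Flags.
Variable e : seq bool.
Let k := size e.
Hypothesis e_last : forall i, i.+1 = k -> nth false e i.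

Let C N i j := count (word_ok e i j) (all_words N).
Let T (c : bool) N i j := count (fun w => word_ok e i j (Some c :: w)) (all_words N).
Let blocks i := count_mem true (drop i e).
Let bd i := (i == 0) || nth false e i.-1.

Lemma countS N i j : C N.+1 i j = T true N i j + T false N i j + (if i == j then C N i j else 0).
Proof.
rewrite /C /= !count_cat !count_map -addnA; congr (_ + (_ + _)).
rewrite [LHS](@eq_count _ _ (fun w => (i == j) && word_ok e i j w)) //.
by case: (i == j) => //=; elim: (all_words N).
Qed.

Lemma countTa N i j : i < k -> T true N i j = if nth false e i then C N i.+1 j
  else if N is N'.+1 then T true N' i.+1 j else 0.
Proof.
move=> ik; rewrite /T /C /=; case h: (nth false e i).
  by apply: eq_count => w; rewrite ik.
case: N => [|N] /=; first by rewrite andbF.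
rewrite !count_cat !count_map /= [X in _ + (X + _)](@eq_count _ _ pred0); last first.
  by move=> w /=; rewrite andbF.
rewrite [X in _ + (_ + X)](@eq_count _ _ pred0); last by move=> w /=; rewrite andbF.
by rewrite !count_pred0 !addn0; apply: eq_count => w /=; rewrite ik.
Qed.

Lemma countTb N i j : j < k -> T false N i j = if nth false e j then C N i j.+1
  else if N is N'.+1 then T false N' i j.+1 else 0.
Proof.
move=> jk; rewrite /T /C /=; case h: (nth false e j).
  by apply: eq_count => w; rewrite jk.
case: N => [|N] /=; first by rewrite andbF.
rewrite !count_cat !count_map /= [X in X + _](@eq_count _ _ pred0); last first.
  by move=> w /=; rewrite andbF.
rewrite [X in _ + (_ + X)](@eq_count _ _ pred0); last by move=> w /=; rewrite andbF.
by rewrite !count_pred0 !addn0 add0n; apply: eq_count => w /=; rewrite jk.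
Qed.

Lemma countTa_end N j : T true N k j = 0.
Proof. by rewrite /T (@eq_count _ _ pred0) ?count_pred0 // => w /=; rewrite ltnn. Qed.

Lemma countTb_end N i : T false N i k = 0.
Proof. by rewrite /T (@eq_count _ _ pred0) ?count_pred0 // => w /=; rewrite ltnn. Qed.

Lemma rk_sum_le w : rk true w (size w) + rk false w (size w) <= size w.
Proof. by elim: w => //= l w IH; rewrite !rk_cons; case: l => [[]|] /=; lia. Qed.

Lemma word_ok_size i j w : word_ok e i j w -> k - i + (k - j) <= size w.
Proof.
case/word_okP => h1 h2 _; have h3 := rk_sum_le w; rewrite /k -{1}h1 -h2; lia.
Qed.

Lemma count_small N i j : N < k - i + (k - j) -> C N i j = 0.
Proof.
move=> h; apply/eqP; rewrite -leqn0 leqNgt -has_count; apply/hasPn => w.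
by rewrite mem_all_words => /eqP hw; apply/negP => /word_ok_size; rewrite hw leqNgt h.
Qed.

Lemma blocksS i : i < k -> blocks i = nth false e i + blocks i.+1.
Proof. by move=> h; rewrite /blocks (drop_nth false h) /= eqb_id. Qed.

Lemma blocks_end : blocks k = 0.
Proof. by rewrite /blocks drop_size. Qed.

Lemma blocks_mono i j : i <= j -> j <= k -> blocks j <= blocks i.
Proof.
move=> /subnKC <-; elim: (j - i) => [|d IH]; first by rewrite addn0.
rewrite addnS => h; apply: leq_trans (IH (ltnW h)).
by rewrite [leqRHS]blocksS ?leq_addl.
Qed.

Lemma blocks_gt i j : i < j -> j <= k -> bd j -> blocks j < blocks i.
Proof.
case: j => // j; rewrite ltnS /bd /= => ij jk h.
by apply: leq_trans (blocks_mono _ _ ij (ltnW jk)); rewrite [leqRHS]blocksS // h.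
Qed.

Lemma bd_end : bd k.
Proof. by rewrite /bd; case E: k => [|m] //=; rewrite e_last. Qed.

Lemma blocks_gt0 i : i < k -> 0 < blocks i.
Proof. by move=> h; rewrite (leq_ltn_trans _ (blocks_gt _ _ h (leqnn _) bd_end)). Qed.

Lemma blocks_eq i j : i <= k -> j <= k -> bd i -> bd j -> (i == j) = (blocks i == blocks j).
Proof.
move=> ik jk bi bj; case: (ltngtP i j) => [h|h|->]; last by rewrite eqxx.
  by have := blocks_gt _ _ h jk bj; case: eqP => // ->; rewrite ltnn.
by have := blocks_gt _ _ h ik bi; case: eqP => // ->; rewrite ltnn.
Qed.

Lemma count_words N :
  [/\ forall i j f, i <= k -> j <= k -> bd i -> bd j -> N = k - i + (k - j) + f ->
        C N i j = block_words (blocks i + blocks j + f) (blocks i) (blocks j),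
      forall i j f, i < k -> j <= k -> bd j -> N = k - i.+1 + (k - j) + f ->
        T true N i j = block_words ((blocks i).-1 + blocks j + f) (blocks i).-1 (blocks j)
    & forall i j f, i <= k -> j < k -> bd i -> N = k - i + (k - j.+1) + f ->
        T false N i j = block_words (blocks i + (blocks j).-1 + f) (blocks i) (blocks j).-1].
Proof.
have half M : (forall i j f, i <= k -> j <= k -> bd i -> bd j -> M = k - i + (k - j) + f ->
        C M i j = block_words (blocks i + blocks j + f) (blocks i) (blocks j)) ->
    (forall M', M'.+1 = M ->
      (forall i j f, i < k -> j <= k -> bd j -> M' = k - i.+1 + (k - j) + f ->
        T true M' i j = block_words ((blocks i).-1 + blocks j + f) (blocks i).-1 (blocks j))
      /\ (forall i j f, i <= k -> j < k -> bd i -> M' = k - i + (k - j.+1) + f ->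
        T false M' i j = block_words (blocks i + (blocks j).-1 + f) (blocks i) (blocks j).-1)) ->
    (forall i j f, i < k -> j <= k -> bd j -> M = k - i.+1 + (k - j) + f ->
        T true M i j = block_words ((blocks i).-1 + blocks j + f) (blocks i).-1 (blocks j))
    /\ (forall i j f, i <= k -> j < k -> bd i -> M = k - i + (k - j.+1) + f ->
        T false M i j = block_words (blocks i + (blocks j).-1 + f) (blocks i) (blocks j).-1).
  move=> hC hT; split=> i j f ik jk b hM.
    rewrite countTa // blocksS //; case h: (nth false e i).
      by rewrite add1n /=; apply: hC.
    have i1 : i.+1 < k by rewrite ltn_neqAle ik andbT; apply/eqP => /e_last; rewrite h.
    case: M hM hC hT => [|M] hM hC hT; first lia.
    by rewrite add0n; apply: (hT M erefl).1 => //; lia.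
  rewrite countTb // [blocks j]blocksS //; case h: (nth false e j).
    by rewrite add1n /=; apply: hC.
  have j1 : j.+1 < k by rewrite ltn_neqAle jk andbT; apply/eqP => /e_last; rewrite h.
  case: M hM hC hT => [|M] hM hC hT; first lia.
  by rewrite add0n; apply: (hT M erefl).2 => //; lia.
elim: N => [|N [IH1 IH2 IH3]].
  have h0 i j f : i <= k -> j <= k -> bd i -> bd j -> 0 = k - i + (k - j) + f ->
      C 0 i j = block_words (blocks i + blocks j + f) (blocks i) (blocks j).
    move=> ik jk _ _ h; have [-> -> ->] : [/\ i = k, j = k & f = 0] by split; lia.
    by rewrite blocks_end /C /= !eqxx.
  by have [h1 h2] := half 0 h0 (fun M' (h : M'.+1 = 0) => ltac:(done)).
have h0 i j f : i <= k -> j <= k -> bd i -> bd j -> N.+1 = k - i + (k - j) + f ->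
    C N.+1 i j = block_words (blocks i + blocks j + f) (blocks i) (blocks j).
  move=> ik jk bi bj hN; rewrite countS.
  have [M eM] : exists M, blocks i + blocks j + f = M.+1.
    have [hi|hi] := ltnP i k; first by have := blocks_gt0 _ hi; exists (blocks i + blocks j + f).-1; lia.
    have [hj|hj] := ltnP j k; first by have := blocks_gt0 _ hj; exists (blocks i + blocks j + f).-1; lia.
    by exists (blocks i + blocks j + f).-1; lia.
  rewrite eM /=; congr (_ + _ + _).
  - case: (ltnP i k) => hi; last first.
      have ei : i = k by lia.
      by rewrite ei countTa_end blocks_end.
    rewrite (IH2 i j f) //; last lia.
    by have := blocks_gt0 _ hi; case: (blocks i) eM => // p; rewrite !addSn => -[<-].
  - case: (ltnP j k) => hj; last first.
      have ej : j = k by lia.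
      by rewrite ej countTb_end blocks_end.
    rewrite (IH3 i j f) //; last lia.
    by have := blocks_gt0 _ hj; case: (blocks j) eM => // p; rewrite addnS addSn => -[<-].
  - rewrite -blocks_eq //; case: eqP => // e0.
    case: f hN eM => [|f] hN eM.
      by rewrite count_small ?block_words_small //; lia.
    by rewrite (IH1 i j f) //; [congr block_words; lia | lia].
have [h1 h2] := half N.+1 h0 (fun M' h => ltac:(by case: h => ->)).
by split.
Qed.

End Flags.

Definition rlmaxn (t : seq nat) : nat := count_mem true (rlmax t).

Lemma count_ok t f :
  count (word_ok (rlmax t) 0 0) (all_words (size t + size t + f)) =
  block_words (rlmaxn t + rlmaxn t + f) (rlmaxn t) (rlmaxn t).
Proof.
have last i : i.+1 = size (rlmax t) -> nth false (rlmax t) i.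
  by rewrite size_rlmax => h; rewrite nth_rlmax -?h // drop_oversize // h.
have [h _ _] := count_words _ last (size t + size t + f).
by rewrite (h 0 0 f) ?drop0 // size_rlmax !subn0.
Qed.

End WordCount.

Section Generate.
Local Open Scope nat_scope.

(* The decomposition of a 132-avoider at its maximum: all of [L] lies above [R]. *)
Definition glue (L R : seq nat) : seq nat :=
  map (addn (size R)) L ++ (size L + size R) :: R.

(* [N] is fuel: any [N >= k] gives all 132-avoiders of size [k]. *)
Fixpoint gen132_fuel (N k : nat) : seq (seq nat) :=
  match N, k with
  | _, 0 => [:: [::]]
  | 0, _ => [::]
  | N'.+1, k'.+1 =>
      [seq glue p.1 p.2 | j <- iota 0 k'.+1,
         p <- [seq (L, R) | L <- gen132_fuel N' j, R <- gen132_fuel N' (k' - j)]]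
  end.

Definition gen132 (k : nat) : seq (seq nat) := gen132_fuel k k.

Lemma gen132_fuelS N k : gen132_fuel N.+1 k.+1 = [seq glue p.1 p.2 | j <- iota 0 k.+1,
  p <- [seq (L, R) | L <- gen132_fuel N j, R <- gen132_fuel N (k - j)]].
Proof. by []. Qed.

Lemma gen132_fuel_stable N k : k <= N -> gen132_fuel N k = gen132 k.
Proof.
suff H M : forall N k, k <= N -> N <= M -> gen132_fuel N k = gen132_fuel k k by move=> /H; apply.
elim: M => [|M IH] [|N'] [|k'] // kN NM; rewrite !gen132_fuelS; congr flatten.
apply/eq_in_map => j; rewrite mem_iota add0n => hj.
by rewrite !(IH N') ?(IH k') //; lia.
Qed.

Lemma gen132_0 : gen132 0 = [:: [::]]. Proof. by []. Qed.

Lemma gen132S k : gen132 k.+1 = [seq glue p.1 p.2 | j <- iota 0 k.+1,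
  p <- [seq (L, R) | L <- gen132 j, R <- gen132 (k - j)]].
Proof.
rewrite /gen132 gen132_fuelS; congr flatten; apply/eq_in_map => j; rewrite mem_iota add0n => hj.
by rewrite !gen132_fuel_stable //; lia.
Qed.

Definition good132 (k : nat) (t : seq nat) : Prop := perm_eq t (iota 0 k) /\ av132 t.

Lemma good132_size k t : good132 k t -> size t = k.
Proof. by case=> /perm_size; rewrite size_iota. Qed.

Lemma good132_mem k t x : good132 k t -> (x \in t) = (x < k).
Proof. by case=> /perm_mem -> _; rewrite mem_iota. Qed.

Lemma good132_uniq k t : good132 k t -> uniq t.
Proof. by case=> /perm_uniq -> _; rewrite iota_uniq. Qed.

Lemma good132I k t : size t = k -> uniq t -> (forall x, x \in t -> x < k) -> av132 t ->
  good132 k t.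
Proof.
move=> st ut lt av; split=> //; apply: uniq_perm (iota_uniq _ _) _ => //.
apply: (uniq_min_size ut _ _).2; last by rewrite size_iota st.
by move=> x /lt h; rewrite mem_iota.
Qed.

Lemma size_glue L R : size (glue L R) = (size L + size R).+1.
Proof. by rewrite size_cat size_map addnS. Qed.

Lemma nth_glue L R i : nth 0 (glue L R) i =
  if i < size L then size R + nth 0 L i
  else if i == size L then size L + size R else nth 0 R (i - (size L).+1).
Proof.
rewrite nth_cat size_map; case: ltnP => h; first by rewrite (nth_map 0).
case: eqP => [->|ne]; first by rewrite subnn.
by have -> : i - size L = (i - (size L).+1).+1 by lia.
Qed.

Lemma good132_glue a b L R : good132 a L -> good132 b R -> good132 (a + b).+1 (glue L R).
Proof.
move=> gL gR; have sL := good132_size _ _ gL; have sR := good132_size _ _ gR.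
have [_ avL] := gL; have [_ avR] := gR.
have mR x : x \in R -> x < b by rewrite (good132_mem _ _ _ gR).
have mL x : x \in L -> x < a by rewrite (good132_mem _ _ _ gL).
apply: good132I.
- by rewrite size_glue sL sR.
- rewrite cat_uniq cons_uniq map_inj_uniq; last exact: addnI.
  rewrite (good132_uniq _ _ gL) (good132_uniq _ _ gR) sL sR /= andbT.
  apply/andP; split; last by apply/negP => /mR; lia.
  rewrite negb_or; apply/andP; split; first by apply/mapP => -[x /mL]; lia.
  by apply/hasPn => x /mR hx; apply/mapP => -[y _]; lia.
- move=> x; rewrite mem_cat inE sL sR => /or3P [/mapP [y /mL hy ->]|/eqP ->|/mR]; lia.
have nR i : i < b -> nth 0 R i < b by move=> h; apply: mR; rewrite mem_nth ?sR.
have nL i : i < a -> nth 0 L i < a by move=> h; apply: mL; rewrite mem_nth ?sL.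
move=> i j l ij jl; rewrite size_glue !nth_glue sL sR => hl.
case: (ltngtP l a) => la.
- have [ja ia] : j < a /\ i < a by split; lia.
  by rewrite ja ia !ltn_add2l; apply: avL => //; rewrite sL.
- have lb : l - a.+1 < b by lia.
  have := nR _ lb.
  case: (ltngtP i a) => ia; [by lia | | by lia].
  have ja : a < j by lia.
  have -> : (j < a) = false by lia.
  have -> : (j == a) = false by lia.
  by move=> _; apply: avR; rewrite ?sR; lia.
- have [ja ia] : j < a /\ i < a by split; lia.
  by rewrite ja ia; have := nL _ ja; lia.
Qed.

Lemma unglue k t : good132 k.+1 t -> exists a b L R,
  [/\ k = a + b, good132 a L, good132 b R & t = glue L R].
Proof.
move=> g; have ut := good132_uniq _ _ g; have st := good132_size _ _ g.
have kt : k \in t by rewrite (good132_mem _ _ _ g).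
have [_ av] := g; have mt x := good132_mem _ _ x g.
have [L [R et]] : exists L R : seq nat, t = L ++ k :: R.
  by case/splitPr: kt => L R; exists L, R.
move: ut st av mt; rewrite {}et => {g kt}.
rewrite cat_uniq cons_uniq => /and4P [uL /hasPn hLR kR uR] sLR av mt.
have kL : k \notin L by apply: hLR; rewrite inE eqxx.
rewrite size_cat /= addnS in sLR; case: sLR => sLR.
have gt x y : x \in L -> y \in R -> y < x.
  move=> xL yR; rewrite ltnNge; apply/negP => xy.
  have ne : x != y by apply/eqP => e; have := hLR y; rewrite inE yR orbT /= -e xL => /(_ isT).
  have yk : y < k.
    have : y \in L ++ k :: R by rewrite mem_cat inE yR !orbT.
    by rewrite mt ltnS leq_eqVlt => /orP [/eqP e|//]; rewrite -e yR in kR.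
  move/(nthP 0): xL => [i hi ei]; move/(nthP 0): yR => [j hj ej].
  apply: (av i (size L) (size L + j.+1)) => //.
  + by rewrite addnS ltnS leq_addr.
  + by rewrite size_cat /= ltn_add2l ltnS.
  rewrite !nth_cat hi ltnn subnn [_ + _ < _]ltnNge leq_addr addKn /= ei ej yk.
  by rewrite ltn_neqAle ne xy.
have inLR x : x < k -> (x \in L) || (x \in R).
  move=> h; have := mt x; rewrite ltnS (ltnW h) mem_cat inE => /or3P [->//|/eqP e|->]; last by rewrite orbT.
  by rewrite e ltnn in h.
have lk x : x \in L ++ R -> x < k.
  move=> h; have : x \in L ++ k :: R by move: h; rewrite !mem_cat inE => /orP [->|->]; rewrite ?orbT.
  rewrite mt ltnS leq_eqVlt => /orP [/eqP e|//].
  by move: h; rewrite mem_cat e (negbTE kL) (negbTE kR).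
have mR x : x \in R -> x < size R.
  move=> xR; rewrite -{1}[x]add0n -(size_iota 0 x.+1) -/(_ <= _).
  apply: uniq_leq_size (iota_uniq _ _) _ => y; rewrite mem_iota /= add0n ltnS => yx.
  have yk : y < k by apply: leq_ltn_trans yx (lk _ _); rewrite mem_cat xR orbT.
  by case/orP: (inLR _ yk) => // yL; have := gt _ _ yL xR; lia.
have mL x : x \in L -> size R <= x.
  move=> xL; rewrite -(size_iota 0 x); apply: uniq_leq_size uR _ => y yR.
  by rewrite mem_iota /= add0n gt.
have nmL i : i < size L -> size R <= nth 0 L i by move=> h; apply: mL; rewrite mem_nth.
pose L' := [seq x - size R | x <- L].
exists (size L), (size R), L', R; split.
- by rewrite sLR.
- apply: good132I.
  + by rewrite size_map.
  + rewrite map_inj_in_uniq // => x y /mL hx /mL hy; lia.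
  + move=> x /mapP [y yL ->]; have := mL _ yL; have : y < k by apply: lk; rewrite mem_cat yL.
    by move=> h1 h2; rewrite ltn_subLR // addnC sLR.
  + move=> i j l ij jl; rewrite size_map => hl; rewrite !(nth_map 0) //; try lia.
    have [h1 h2] : size R <= nth 0 L i /\ size R <= nth 0 L j by split; apply: nmL; lia.
    have h3 := nmL _ hl.
    have := av i j l ij jl; rewrite size_cat !nth_cat hl.
    have -> : j < size L by lia.
    have -> : i < size L by lia.
    by move=> h4 [h5 h6]; apply: h4; [apply: leq_trans hl (leq_addr _ _) | split; lia].
- apply: good132I => //.
  move=> i j l ij jl hl [h1 h2].
  apply: (av (size L + i.+1) (size L + j.+1) (size L + l.+1)); rewrite ?ltn_add2l //.
    by rewrite size_cat /= ltn_add2l ltnS.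
  by rewrite !nth_cat ![size L + _ < _]ltnNge !leq_addr !addKn /=.
rewrite /glue /L' size_map sLR; congr (_ ++ _).
rewrite -map_comp -[LHS]map_id; apply/eq_in_map => x /mL h /=; lia.
Qed.

Lemma mem_gen132 k t : t \in gen132 k <-> good132 k t.
Proof.
elim/ltn_ind: k t => -[|k] IH t.
  rewrite gen132_0 inE; split=> [/eqP ->|/good132_size /size0nil ->//].
  by split=> // i j l.
rewrite gen132S; split.
  case/allpairsPdep => j [p [hj /allpairsPdep [L [R [hL hR ->]]] ->]].
  move: hj; rewrite mem_iota add0n => hj /=.
  have -> : k.+1 = (j + (k - j)).+1 by lia.
  by apply: good132_glue; apply/IH => //; lia.
move=> /unglue [a [b [L [R [ek gL gR ->]]]]]; subst k; apply/allpairsPdep.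
exists a, (L, R); split=> //; first by rewrite mem_iota; lia.
by apply/allpairsPdep; exists L, R; rewrite addKn; split=> //; apply/IH => //; lia.
Qed.

Lemma index_glue a L R : good132 a L -> index (size L + size R) (glue L R) = size L.
Proof.
move=> g; rewrite index_cat; case: ifP => [/mapP [x]|_].
  by rewrite (good132_mem _ _ _ g) (good132_size _ _ g); lia.
by rewrite size_map /= eqxx addn0.
Qed.

Lemma gen132_uniq k : uniq (gen132 k).
Proof.
elim/ltn_ind: k => -[|k] IH //; rewrite gen132S.
apply: allpairs_uniq_dep; first exact: iota_uniq.
  move=> j; rewrite mem_iota add0n => hj; apply: allpairs_uniq; try (apply: IH; lia).
  by move=> [? ?] [? ?] _ _ [-> ->].
have key x : x \in [seq @Tagged nat j (fun=> (seq nat * seq nat)%type) y | j <- iota 0 k.+1,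
      y <- [seq (L, R) | L <- gen132 j, R <- gen132 (k - j)]] ->
    [/\ good132 (tag x) (tagged x).1, size (tagged x).2 = k - tag x & tag x <= k].
  case/allpairsPdep => j [p [hj /allpairsPdep [L [R [hL hR ->]]] ->]] /=; split.
  - exact/mem_gen132.
  - by apply: (good132_size (k - j)); apply/mem_gen132.
  - by move: hj; rewrite mem_iota.
move=> [j [L R]] [j' [L' R']] /key /= [g1 s1 l1] /key /= [g2 s2 l2] e.
have i1 := index_glue _ _ R g1; have i2 := index_glue _ _ R' g2.
have sL := good132_size _ _ g1; have sL' := good132_size _ _ g2.
rewrite sL s1 subnKC // in i1; rewrite sL' s2 subnKC // in i2.
have ej : j = j' by rewrite -i1 -i2 /= e.
have sLL : size L = size L' by rewrite sL sL'.
clear sL' i2; subst j'; move/eqP: e; rewrite /glue eqseq_cat ?size_map // s1 s2.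
case/andP=> /eqP e1 /eqP [_ ->].
by rewrite (inj_map (@addnI _) e1).
Qed.

End Generate.

Section Coefficients.
Local Open Scope nat_scope.

Lemma rlmaxn_glue a L R : good132 a L -> (forall x, x \in R -> x < size R) ->
  rlmaxn (glue L R) = (rlmaxn R).+1.
Proof.
move=> gL hR; rewrite /glue; set m := size L + size R.
have mL x : x \in map (addn (size R)) L -> x < m.
  move=> /mapP [y]; rewrite (good132_mem _ _ _ gL) -(good132_size _ _ gL) => h ->.
  by rewrite addnC ltn_add2r.
elim: (map _ L) mL => [|x s IH] mL; rewrite /rlmaxn /=.
  have -> : all (fun y => y < m) R by apply/allP => y /hR h; rewrite ltn_addl.
  by rewrite add1n.
have -> : all (fun y => y < x) (s ++ m :: R) = false.
  apply/negbTE/allPn; exists m; first by rewrite mem_cat inE eqxx orbT.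
  by rewrite -leqNgt ltnW // mL // inE eqxx.
by rewrite add0n; apply: IH => y hy; apply: mL; rewrite inE hy orbT.
Qed.

Lemma rlmaxn_le t : rlmaxn t <= size t.
Proof. by rewrite -[leqRHS]size_rlmax count_size. Qed.

Lemma rlmaxn_gt0 x t : 0 < rlmaxn (x :: t).
Proof.
elim: t x => [|y t IH] x //.
by rewrite /rlmaxn /= -[_ + count_mem _ _]/(rlmaxn (y :: t)) ltn_addl.
Qed.

(* Sizes are tripled: an entry of [t] stands for a 3-cycle, of weight [z ^ 3]. *)
Definition genz (m : nat) : seq (seq nat) := if 3 %| m then gen132 (m %/ 3) else [::].

Definition icoef (m : nat) : nat :=
  if (3 %| m) && (0 < m) then size (gen132 (m %/ 3).-1) else 0.

Lemma genz3 k : genz (3 * k) = gen132 k.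
Proof. by rewrite /genz dvdn_mulr // mulKn. Qed.

Lemma icoef3 k : icoef (3 * k.+1) = size (gen132 k).
Proof. by rewrite /icoef dvdn_mulr // mulKn. Qed.

Lemma icoef0 : icoef 0 = 0. Proof. by []. Qed.

Lemma icoefN3 m : ~~ (3 %| m) -> icoef m = 0.
Proof. by rewrite /icoef => /negbTE ->. Qed.

Lemma genzN3 m : ~~ (3 %| m) -> genz m = [::].
Proof. by rewrite /genz => /negbTE ->. Qed.

Lemma sum_mult3 (u : nat -> nat) n : (forall j, ~~ (3 %| j) -> u j = 0) ->
  \sum_(j < (3 * n).+1) u j = u 0 + \sum_(i < n) u (3 * i.+1).
Proof.
move=> u0; elim: n => [|n IH]; first by rewrite muln0 big_ord1 big_ord0 addn0.
have e3 : 3 * n.+1 = (3 * n).+3 by lia.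
have step M : \sum_(j < M.+2) u j = \sum_(j < M.+1) u j + u M.+1 by rewrite big_ord_recr.
rewrite [in LHS]e3 !step IH [in RHS]big_ord_recr /= e3.
have -> : u (3 * n).+1 = 0 by apply: u0; lia.
have -> : u (3 * n).+2 = 0 by apply: u0; lia.
by rewrite !addn0 -addnA.
Qed.

Lemma sum_gen_head (F : nat -> nat) k :
  \sum_(t <- gen132 k.+1) (if rlmaxn t is r.+1 then F r else 0) =
  \sum_(j < k.+1) size (gen132 j) * \sum_(t <- gen132 (k - j)) F (rlmaxn t).
Proof.
rewrite gen132S big_allpairs_dep -[iota _ _]/(index_iota 0 k.+1) big_mkord.
apply: eq_bigr => j _; rewrite big_allpairs_dep /=.
rewrite -sum1_size big_distrl /= !big_seq; apply: eq_bigr => L /mem_gen132 gL.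
rewrite mul1n !big_seq; apply: eq_bigr => R /mem_gen132 gR.
rewrite (rlmaxn_glue _ _ _ gL) // => x.
by rewrite (good132_mem _ _ _ gR) (good132_size _ _ gR).
Qed.

Lemma sum_genz_head (F : nat -> nat) m :
  \sum_(t <- genz m) (if rlmaxn t is r.+1 then F r else 0) =
  \sum_(j < m.+1) icoef j * \sum_(t <- genz (m - j)) F (rlmaxn t).
Proof.
case: (boolP (3 %| m)) => [/dvdnP [k ->]|h]; last first.
  rewrite genzN3 // big_nil big1 // => j _.
  case: (boolP (3 %| j)) => hj; last by rewrite icoefN3.
  by rewrite genzN3 ?big_nil ?muln0 // -(dvdn_addl _ hj) subnK // -ltnS.
rewrite mulnC genz3; case: k => [|k].
  by rewrite muln0 big_ord1 gen132_0 big_seq1.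
rewrite (sum_mult3 (fun j => icoef j * \sum_(t <- genz (3 * k.+1 - j)) F (rlmaxn t))).
  rewrite icoef0 mul0n add0n sum_gen_head; apply: eq_bigr => j _.
  by rewrite icoef3 -mulnBr subSS genz3.
by move=> j hj; rewrite icoefN3.
Qed.

Lemma sum_triangle (g : nat -> nat -> nat -> nat) n :
  \sum_(m < n.+1) \sum_(j < m.+1) g j (m - j) (n - m) =
  \sum_(j < n.+1) \sum_(l < (n - j).+1) g j l (n - j - l).
Proof.
elim: n g => [|n IH] g; first by rewrite !big_ord1.
transitivity (\sum_(m < n.+2) (g 0 m (n.+1 - m) + \sum_(j < m) g j.+1 (m - j.+1) (n.+1 - m))).
  by apply: eq_bigr => m _; rewrite big_ord_recl /= subn0; congr (_ + _); apply: eq_bigr.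
rewrite big_split /= [RHS]big_ord_recl /= subn0; congr (_ + _).
rewrite big_ord_recl big_ord0 add0n -(IH (fun j => g j.+1)).
by apply: eq_bigr => m _; apply: eq_bigr => j _; rewrite /= !subSS.
Qed.

Definition Hpart (d m f : nat) : nat :=
  \sum_(t <- genz m) block_words (rlmaxn t + (rlmaxn t + d) + f) (rlmaxn t) (rlmaxn t + d).

Definition Hcoef (d n : nat) : nat := \sum_(m < n.+1) Hpart d m (n - m).

Lemma Hpart_S d m f : Hpart d.+1 m f = \sum_(j < m.+1) icoef j * Hpart d.+2 (m - j) f + Hpart d m f.
Proof.
rewrite /Hpart -(sum_genz_head (fun r => block_words (r + (r + d.+2) + f) r (r + d.+2))) -big_split.
apply: eq_bigr => t _ /=; set r := rlmaxn t.
rewrite !addnS addSn /= ltn_eqF ?addn0 1?ltnS ?leq_addr //.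
by case: r => // r; rewrite !addSn !addnS.
Qed.

Lemma Hpart_0 m f : Hpart 0 m f = 2 * (\sum_(j < m.+1) icoef j * Hpart 1 (m - j) f)
  + (if f is f'.+1 then Hpart 0 m f' else m == 0).
Proof.
rewrite /Hpart -(sum_genz_head (fun r => block_words (r + (r + 1) + f) r (r + 1))).
have step r : block_words (r + (r + 0) + f) r (r + 0) =
    2 * (if r is r'.+1 then block_words (r' + (r' + 1) + f) r' (r' + 1) else 0) +
    (if f is f'.+1 then block_words (r + (r + 0) + f') r (r + 0) else r == 0).
  rewrite !addn0; case: r => [|r].
    by case: f => [|f] /=; rewrite ?muln0 ?add0n.
  rewrite !addSn /= !addnS !addSn !addn0 eqxx.
  rewrite [block_words _ r.+1 r]block_words_sym mul2n -addnn.
  case: f => [|f]; last by rewrite !addnS !addSn /= !eqxx.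
  by rewrite [block_words _ r.+1 r.+1]block_words_small ?addn0 //; lia.
under eq_bigr do rewrite step.
rewrite big_split /= -big_distrr; congr (_ + _).
case: f step => // step; case: (boolP (3 %| m)) => [/dvdnP [k ->]|h].
  rewrite mulnC genz3; case: k => [|k]; first by rewrite gen132_0 big_seq1.
  rewrite big_seq big1 // => t /mem_gen132 /good132_size.
  by case: t => // x t _; rewrite gtn_eqF // rlmaxn_gt0.
by rewrite genzN3 // big_nil; case: m h.
Qed.

Lemma Hcoef_conv d n : \sum_(m < n.+1) \sum_(j < m.+1) icoef j * Hpart d (m - j) (n - m) =
  \sum_(j < n.+1) icoef j * Hcoef d (n - j).
Proof.
rewrite (sum_triangle (fun j l f => icoef j * Hpart d l f)).
by apply: eq_bigr => j _; rewrite /Hcoef big_distrr.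
Qed.

Lemma HcoefS d n : Hcoef d.+1 n = \sum_(j < n.+1) icoef j * Hcoef d.+2 (n - j) + Hcoef d n.
Proof. by rewrite -Hcoef_conv -big_split; apply: eq_bigr => m _; exact: Hpart_S. Qed.

Lemma Hcoef0 n : Hcoef 0 n = 2 * (\sum_(j < n.+1) icoef j * Hcoef 1 (n - j))
  + (if n is n'.+1 then Hcoef 0 n' else 1).
Proof.
rewrite -Hcoef_conv {1}/Hcoef (eq_bigr _ (fun (m : 'I_n.+1) _ => Hpart_0 m (n - m))) big_split /= -big_distrr.
congr (_ + _); case: n => [|n]; first by rewrite big_ord1.
rewrite big_ord_recr /= subnn addn0; apply: eq_bigr => m _.
by rewrite subSn // -ltnS.
Qed.

Lemma size_genS k : size (gen132 k.+1) = \sum_(j < k.+1) size (gen132 j) * size (gen132 (k - j)).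
Proof.
rewrite -sum1_size gen132S big_allpairs_dep -[iota _ _]/(index_iota 0 k.+1) big_mkord.
by apply: eq_bigr => j _; rewrite sum1_size size_allpairs.
Qed.

Lemma icoefE n : icoef n = (n == 3) + \sum_(j < n.+1) icoef j * icoef (n - j).
Proof.
case: (boolP (3 %| n)) => [/dvdnP [k ->]|h]; last first.
  rewrite icoefN3 // big1; first by case: eqP h => // ->.
  move=> j _; case: (boolP (3 %| j)) => hj; last by rewrite icoefN3.
  by rewrite [icoef (n - j)]icoefN3 ?muln0 // -(dvdn_addl _ hj) subnK // -ltnS.
rewrite mulnC; case: k => [|k]; first by rewrite muln0 big_ord1.
rewrite (sum_mult3 (fun j => icoef j * icoef (3 * k.+1 - j))); last first.
  by move=> j hj; rewrite icoefN3.
rewrite icoef0 mul0n add0n icoef3 big_ord_recr /= subnn muln0 addn0.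
case: k => [|k]; first by rewrite big_ord0.
rewrite size_genS gtn_eqF ?add0n; last lia.
apply: eq_bigr => j _; rewrite icoef3 -mulnBr subSS subSn; last by rewrite -ltnS.
by rewrite icoef3.
Qed.

(* The partial sums of c(1/4), scaled: S_(N+1) <= 1 + S_N^2 / 4 keeps them below 2. *)
Lemma catalan_bound N : \sum_(k < N.+1) size (gen132 k) * expn 4 (N - k) <= 2 * expn 4 N.
Proof.
elim: N => [|N IH]; first by rewrite big_ord1.
rewrite big_ord_recl /= mul1n subn0 mul2n -addnn leq_add2l.
rewrite -(@leq_pmul2l (expn 4 N)) ?expn_gt0 //.
set S := \sum_(k < N.+1) _ in IH.
apply: (@leq_trans (S * S)); last first.
  by apply: leq_trans (leq_mul IH IH) _; rewrite expnS; nia.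
rewrite big_distrr /=.
under eq_bigr => k _ do rewrite /bump add1n subSS size_genS big_distrl big_distrr /=.
rewrite (eq_bigr (fun k : 'I_N.+1 => \sum_(j < k.+1) (size (gen132 j) * expn 4 (N - j)) *
    (size (gen132 (k - j)) * expn 4 (N - (k - j))))); last first.
  move=> k _; apply: eq_bigr => j _; rewrite mulnACA mulnCA -!expnD.
  by congr (_ * expn 4 _); have := ltn_ord k; have := ltn_ord j; lia.
rewrite (sum_triangle (fun j l _ => (size (gen132 j) * expn 4 (N - j)) * (size (gen132 l) * expn 4 (N - l)))).
rewrite /S big_distrl; apply: leq_sum => j _; rewrite -big_distrr leq_mul2l; apply/orP; right.
rewrite -!(big_mkord xpredT (fun l => size (gen132 l) * expn 4 (N - l))).
by rewrite [leqRHS](@big_cat_nat _ _ _ (N - j).+1) ?leq_addr // ltnS leq_subr.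
Qed.

Lemma size_gen_le k : size (gen132 k) <= 2 * expn 4 k.
Proof.
apply: leq_trans (catalan_bound k); rewrite big_ord_recr /= subnn muln1.
exact: leq_addl.
Qed.

Lemma icoef_le n : icoef n <= 2 * expn 4 n.
Proof.
rewrite /icoef; case: ifP => // _; apply: leq_trans (size_gen_le _) _.
by rewrite leq_mul2l leq_exp2l //; lia.
Qed.

Lemma Hcoef_le d n : Hcoef d n <= 2 * expn 72 n * expn 3 d.
Proof.
have h m : m <= n -> Hpart d m (n - m) <= 2 * expn 4 n * expn 3 (n + n + d).
  move=> mn; rewrite /Hpart.
  apply: (@leq_trans (\sum_(t <- genz m) expn 3 (n + n + d))).
    rewrite big_seq [leqRHS]big_seq; apply: leq_sum => t ht.
    apply: leq_trans (block_words_bound _ _ _) _; rewrite leq_exp2l //.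
    have := rlmaxn_le t; move: ht; rewrite /genz; case: ifP => // _.
    by move=> /mem_gen132 /good132_size ->; lia.
  rewrite big_const_seq count_predT iter_addn_0 mulnC leq_mul2r; apply/orP; right.
  rewrite /genz; case: ifP => // _; apply: leq_trans (size_gen_le _) _.
  by rewrite leq_mul2l leq_exp2l //; lia.
apply: (@leq_trans (\sum_(m < n.+1) 2 * expn 4 n * expn 3 (n + n + d))).
  by apply: leq_sum => m _; apply: h; rewrite -ltnS.
rewrite big_const_ord iter_addn_0.
have -> : 72 = 4 * 9 * 2 by [].
have e9 : expn 9 n = expn 3 n * expn 3 n by rewrite -expnMn.
rewrite !expnMn !expnD e9.
have : n.+1 <= expn 2 n by rewrite ltn_expl.
set a := expn 4 n; set b := expn 3 n; set c := expn 3 d; set e := expn 2 n => he.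
have -> : 2 * (a * (b * b) * e) * c = 2 * a * (b * b * c) * e by lia.
by rewrite leq_mul2l he orbT.
Qed.

End Coefficients.

Section Count.
Local Open Scope nat_scope.

Definition tops (n : nat) : seq (seq nat) := [seq t | m <- iota 0 n.+1, t <- genz m].

Definition codes (n : nat) : seq (seq nat * seq letter) :=
  [seq (t, w) | t <- tops n, w <- [seq w <- all_words (n - size t) | word_ok (rlmax t) 0 0 w]].

Lemma genz_good m t : t \in genz m -> good132 (size t) t /\ m = 3 * size t.
Proof.
rewrite /genz; case: ifP => // h /mem_gen132 g; rewrite (good132_size _ _ g).
by split=> //; rewrite mulnC divnK.
Qed.

Lemma mem_codes n t w : (t, w) \in codes n <-> code_ok n t w.
Proof.
split.
  case/allpairsPdep => t' [w' [/allpairsPdep [m [u [hm hu ->]]]]].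
  rewrite mem_filter mem_all_words => /andP [hok /eqP sw] [-> ->].
  have [[pu av] em] := genz_good _ _ hu.
  move: hm; rewrite mem_iota /= => hm; split=> //.
  by rewrite sw subnKC // (@leq_trans m) // em leq_pmull.
case=> pt av sz hok; apply/allpairsPdep; exists t, w; split=> //; last first.
  by rewrite mem_filter hok mem_all_words -sz addKn eqxx.
apply/allpairsPdep; exists (3 * size t), t; split=> //; last first.
  by rewrite genz3; apply/mem_gen132.
have := word_ok_size _ _ _ _ hok; rewrite size_rlmax !subn0 => h.
rewrite mem_iota /= add0n ltnS -sz.
by rewrite -[3]/(1 + 2) mulnDl mul1n mul2n -addnn leq_add2l.
Qed.

Lemma codes_uniq n : uniq (codes n).
Proof.
apply: allpairs_uniq_dep; last by move=> [t w] [t' w'] _ _ /= [-> ->].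
  apply: allpairs_uniq_dep; first exact: iota_uniq.
    by move=> m _; rewrite /genz; case: ifP => // _; exact: gen132_uniq.
  have key x : x \in [seq @Tagged nat m (fun=> seq nat) t | m <- iota 0 n.+1, t <- genz m] ->
      tag x = 3 * size (tagged x).
    by case/allpairsPdep => m [t [_ /genz_good [_ h] ->]].
  by move=> [m t] [m' t'] /key /= -> /key /= -> /= ->.
by move=> t _; rewrite filter_uniq // all_words_uniq.
Qed.

Lemma size_codes n : size (codes n) = Hcoef 0 n.
Proof.
rewrite -sum1_size !big_allpairs_dep -[iota _ _]/(index_iota 0 n.+1) big_mkord.
apply: eq_bigr => m _; rewrite /Hpart big_seq [RHS]big_seq; apply: eq_bigr => t /genz_good [_ em].
rewrite sum1_size size_filter addn0 -count_ok.
congr (count _ (all_words _)); move: em (ltn_ord m); move: (size t) => k; lia.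
Qed.

Lemma cycles13P n (s : {perm 'I_n}) : reflect (forall x, s (s (s x)) = x) (cycles13 s).
Proof.
apply: (iffP forallP) => h x.
  by have := iter_porbit s x; case/orP: (h x) => /eqP -> /= e; rewrite ?e.
have it k : iter k.+3 s x = iter k s x by rewrite -addn3 iterD /= h.
have ne := card_porbit_neq0 s x.
have [e1|e1] := eqVneq (s x) x.
  have sub : porbit s x \subset [set x].
    apply/subsetP => y /porbitP [i ->]; rewrite inE permX.
    by apply/eqP; elim: i => //= i ->.
  by have := subset_leq_card sub; rewrite cards1; case: #|_| ne => [|[|]].
have sub : porbit s x \subset [:: x; s x; s (s x)].
  apply/subsetP => y /porbitP [i ->]; rewrite permX.
  elim/ltn_ind: i => -[|[|[|i]]] IH; rewrite ?it ?inE ?eqxx ?orbT //.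
  by have := IH i _; rewrite !inE; apply; lia.
have := leq_trans (subset_leq_card sub) (card_size _); have ip := iter_porbit s x.
case E: #|_| ne ip => [|[|[|[|k]]]] // _ ip _.
  by move: ip (h x) => /= -> /eqP; rewrite (negbTE e1).
Qed.

Definition permfun (n : nat) (s : {perm 'I_n}) (x : nat) : nat :=
  if insub x is Some i then val (s i) else x.

Lemma permfunE n (s : {perm 'I_n}) (i : 'I_n) : permfun n s i = s i.
Proof. by rewrite /permfun valK. Qed.

Lemma avoids132P n (s : {perm 'I_n}) (g : nat -> nat) : (forall i : 'I_n, val (s i) = g i) ->
  reflect (av132f n g) (avoids132 s).
Proof.
move=> sg; apply: (iffP negP) => h.
  move=> x y z xy yz zn [h1 h2]; apply: h.
  have yn : y < n := ltn_trans yz zn; have xn : x < n := ltn_trans xy yn.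
  apply/existsP; exists (Ordinal xn); apply/existsP; exists (Ordinal yn).
  by apply/existsP; exists (Ordinal zn); rewrite /= xy yz !sg /= h1 h2.
move=> /existsP [i /existsP [j /existsP [k /and4P [h1 h2]]]].
by rewrite !sg => h3 h4; apply: (h i j k).
Qed.

Lemma code_perm n t w : code_ok n t w ->
  exists s : {perm 'I_n}, [forall i, val (s i) == decode t w i].
Proof.
move=> c.
have inj : injective (fun i : 'I_n => Ordinal (decode_lt _ _ _ c _ (ltn_ord i))).
  move=> i j [e]; apply: val_inj => /=.
  by rewrite -(decode3 _ _ _ c i (ltn_ord i)) e (decode3 _ _ _ c).
by exists (perm inj); apply/forallP => i; rewrite permE.
Qed.

Definition perm_of (n : nat) (c : seq nat * seq letter) : {perm 'I_n} :=
  odflt 1%g [pick s : {perm 'I_n} | [forall i, val (s i) == decode c.1 c.2 i]].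

Lemma perm_ofE n t w (i : 'I_n) : code_ok n t w -> val (perm_of n (t, w) i) = decode t w i.
Proof.
move=> c; rewrite /perm_of; case: pickP => [s /forallP h|none]; first exact/eqP.
by have [s hs] := code_perm _ _ _ c; rewrite none in hs.
Qed.

Lemma a13E n : a13 n = Hcoef 0 n.
Proof.
rewrite -size_codes -(size_map (perm_of n)).
have u : uniq (map (perm_of n) (codes n)).
  rewrite map_inj_in_uniq ?codes_uniq // => -[t w] [t' w'] /mem_codes c /mem_codes c' e.
  have [|-> ->] // := decode_inj _ _ _ _ _ c c' _.
  by move=> x hx; rewrite -(perm_ofE _ _ _ (Ordinal hx) c) e (perm_ofE _ _ _ _ c').
rewrite -(card_uniqP u); apply: eq_card => s; rewrite inE; apply/andP/mapP.
  case=> /(avoids132P _ _ _ (fun i => esym (permfunE n s i))) av /cycles13P cyc.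
  have lt x : x < n -> permfun n s x < n.
    by move=> h; rewrite -[x]/(val (Ordinal h)) permfunE.
  have cyc' x : x < n -> permfun n s (permfun n s (permfun n s x)) = x.
    by move=> h; rewrite -[x in LHS]/(val (Ordinal h)) !permfunE cyc.
  have [t [w [c h]]] := encode_exists _ _ lt cyc' av.
  exists (t, w); first exact/mem_codes.
  by apply/permP => i; apply: val_inj; rewrite perm_ofE // h // permfunE.
case=> -[t w] /mem_codes c ->; have E i := perm_ofE n t w i c; split.
  by apply/(avoids132P _ _ _ E); exact: decode_av c.
by apply/cycles13P => x; apply: val_inj; rewrite !E (decode3 _ _ _ c).
Qed.

End Count.

Lemma INR_sum (F : nat -> nat) n :
  INR (\sum_(j < n.+1) F j)%nat = sum_f_R0 (fun j => INR (F j)) n.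
Proof.
elim: n => [|n IH]; first by rewrite big_ord1.
by rewrite big_ord_recr plus_INR IH.
Qed.

Lemma INR_expn a n : INR (expn a n) = INR a ^ n.
Proof. by elim: n => [|n IH] //; rewrite expnS mult_INR IH. Qed.

Lemma INR_leq (m n : nat) : (m <= n)%nat -> INR m <= INR n.
Proof. by move=> /leP; apply: le_INR. Qed.

Lemma ex_series_geom_dom (u : nat -> R) C :
  (forall n, Rabs (u n) <= C * (1 / 2) ^ n) -> ex_series (fun n => Rabs (u n)).
Proof.
move=> h; apply: (@ex_series_le R_AbsRing R_CompleteNormedModule _ (fun n => C * (1 / 2) ^ n)).
  by move=> n; rewrite /norm /= /abs /= Rabs_Rabsolu.
apply: (@ex_series_scal_l R_AbsRing R_NormedModule) => //.
by apply: ex_series_geom; rewrite Rabs_pos_eq; lra.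
Qed.

Lemma Series_geom_dom (u : nat -> R) C :
  (forall n, Rabs (u n) <= C * (1 / 2) ^ n) -> Rabs (Series u) <= 2 * C.
Proof.
move=> h; apply: Rle_trans (Series_Rabs _ (ex_series_geom_dom _ _ h)) _.
have g : Rabs (1 / 2) < 1 by rewrite Rabs_pos_eq; lra.
have -> : 2 * C = Series (fun n => C * (1 / 2) ^ n).
  by rewrite Series_scal_l Series_geom //; field.
apply: Series_le; first by move=> n; split; [exact: Rabs_pos | exact: h].
by apply: (@ex_series_scal_l R_AbsRing R_NormedModule); apply: ex_series_geom.
Qed.

Lemma is_series_single (m : nat) (a : R) : is_series (fun n => if n == m then a else 0) a.
Proof.
apply: (filterlim_ext_loc (fun _ => a)); last exact: filterlim_const.
exists m => n /leP hn; rewrite sum_n_Reals.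
suff -> : sum_f_R0 (fun n => if n == m then a else 0) n = if leq m n then a else 0 by rewrite hn.
elim: n {hn} => [|n IH] /=; first by rewrite leqn0 eq_sym.
by rewrite IH [leq m n.+1]leq_eqVlt ltnS eq_sym; case: eqP => [->|_]; rewrite ?ltnn /=; ring.
Qed.

Lemma geom_squeeze (x C q : R) : 0 <= q < 1 -> (forall d, Rabs x <= C * q ^ d) -> x = 0.
Proof.
move=> [q0 q1] h; apply: Rabs_eq_0; apply: Rle_antisym; last exact: Rabs_pos.
have l : is_lim_seq (fun d => C * q ^ d) (C * 0).
  apply: (is_lim_seq_scal_l _ C 0); apply: is_lim_seq_geom; rewrite Rabs_pos_eq //.
have := is_lim_seq_le _ _ _ _ h (is_lim_seq_const _) l.
by rewrite /= Rmult_0_r.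
Qed.

Section Evaluation.
Variable z : R.
Hypothesis z_small : Rabs z < 1 / 1000.

Let iz n := INR (icoef n) * z ^ n.
Let hs d n := INR (Hcoef d n) * z ^ n.
Let I := Series iz.
Let H d := Series (hs d).

Lemma pow_le_half (a : R) n : 0 <= a <= 500 -> a ^ n * Rabs z ^ n <= (1 / 2) ^ n.
Proof.
move=> ha; rewrite -Rpow_mult_distr; apply: pow_incr; split.
  by apply: Rmult_le_pos; [lra | exact: Rabs_pos].
by have := Rabs_pos z; nra.
Qed.

Lemma iz_dom n : Rabs (iz n) <= 1 / 50 * (1 / 2) ^ n.
Proof.
rewrite /iz Rabs_mult -RPow_abs Rabs_pos_eq; last exact: pos_INR.
case: n => [|n]; first by rewrite icoef0 /=; lra.
have := INR_leq _ _ (icoef_le n.+1); rewrite mult_INR INR_expn !INR_IZR_INZ /= => h.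
have p := Rabs_pos z; have pn : 0 <= Rabs z ^ n by apply: pow_le.
have q := pow_le_half 4 n ltac:(lra).
have q4 : 0 <= 4 ^ n by apply: pow_le; lra.
apply: (Rle_trans _ (2 * (4 * 4 ^ n) * (Rabs z * Rabs z ^ n))).
  apply: Rmult_le_compat_r; first by apply: Rmult_le_pos.
  by apply: Rle_trans h _; lra.
have -> : 2 * (4 * 4 ^ n) * (Rabs z * Rabs z ^ n) = 8 * Rabs z * (4 ^ n * Rabs z ^ n) by ring.
have : 0 <= 4 ^ n * Rabs z ^ n by apply: Rmult_le_pos.
by nra.
Qed.

Lemma hs_dom d n : Rabs (hs d n) <= 2 * 3 ^ d * (1 / 2) ^ n.
Proof.
rewrite /hs Rabs_mult -RPow_abs Rabs_pos_eq; last exact: pos_INR.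
have := INR_leq _ _ (Hcoef_le d n); rewrite !mult_INR !INR_expn => h.
have p := Rabs_pos z; have pn : 0 <= Rabs z ^ n by apply: pow_le.
have q := pow_le_half 72 n ltac:(lra).
have q3 : 0 <= 3 ^ d by apply: pow_le; lra.
have e72 : INR 72 = 72 by rewrite INR_IZR_INZ.
have e3 : INR 3 = 3 by rewrite INR_IZR_INZ.
rewrite e72 e3 [INR 2]/= in h.
apply: (Rle_trans _ (2 * 72 ^ n * 3 ^ d * Rabs z ^ n)).
  by apply: Rmult_le_compat_r => //; lra.
have -> : 2 * 72 ^ n * 3 ^ d * Rabs z ^ n = 2 * 3 ^ d * (72 ^ n * Rabs z ^ n) by ring.
by apply: Rmult_le_compat_l => //; lra.
Qed.

Lemma is_series_iz : is_series iz I.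
Proof. exact: Series_correct _ (ex_series_Rabs _ (ex_series_geom_dom _ _ iz_dom)). Qed.

Lemma is_series_hs d : is_series (hs d) (H d).
Proof. exact: Series_correct _ (ex_series_Rabs _ (ex_series_geom_dom _ _ (hs_dom d))). Qed.

Lemma is_series_conv (b : nat -> nat) B C :
  (forall n, Rabs (INR (b n) * z ^ n) <= C * (1 / 2) ^ n) ->
  is_series (fun n => INR (b n) * z ^ n) B ->
  is_series (fun n => INR (\sum_(j < n.+1) icoef j * b (n - j))%nat * z ^ n) (I * B).
Proof.
move=> hb sb.
have := is_series_mult _ _ _ _ is_series_iz sb
  (ex_series_geom_dom _ _ iz_dom)
  (ex_series_geom_dom _ _ hb).
apply: is_series_ext => n; rewrite (INR_sum (fun j => icoef j * b (n - j))%nat).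
rewrite Rmult_comm scal_sum; apply: sum_eq => j hj.
have -> : z ^ n = z ^ j * z ^ (n - j)%coq_nat by rewrite -pow_add; congr (_ ^ _); lia.
by rewrite /iz mult_INR -minusE; ring.
Qed.

Lemma I_eq : I = z ^ 3 + I * I.
Proof.
apply: (is_series_unique iz); 
have := is_series_plus _ _ _ _ (is_series_single 3 (z ^ 3)) (is_series_conv _ _ _ iz_dom is_series_iz).
apply: is_series_ext => n; rewrite /iz [in RHS]icoefE plus_INR Rmult_plus_distr_r.
by rewrite /plus /=; congr (_ + _); case: eqP => [->|_] /=; ring.
Qed.

Lemma H_step d : H d.+1 = I * H d.+2 + H d.
Proof.
apply: (is_series_unique (hs d.+1)).
have := is_series_plus _ _ _ _ (is_series_conv _ _ _ (hs_dom d.+2) (is_series_hs d.+2)) (is_series_hs d).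
apply: is_series_ext => n; rewrite /hs [in RHS]HcoefS plus_INR Rmult_plus_distr_r.
by [].
Qed.

Lemma H_zero : H 0%nat = 1 + z * H 0%nat + 2 * (I * H 1%nat).
Proof.
apply: (is_series_unique (hs 0%nat)).
have sh : is_series (fun n => INR (if n is n'.+1 then Hcoef 0 n' else 1%nat) * z ^ n) (1 + z * H 0%nat).
  apply: is_series_decr_1; rewrite /plus /opp /=.
  have -> : 1 + z * H 0%nat + - (1 * 1) = z * H 0%nat by ring.
  apply: is_series_ext (is_series_scal_l z _ _ (is_series_hs 0%nat)) => n.
  by rewrite /scal /= /mult /= /hs; ring.
have := is_series_plus _ _ _ _ sh
  (is_series_scal_l 2 _ _ (is_series_conv _ _ _ (hs_dom 1%nat) (is_series_hs 1%nat))).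
apply: is_series_ext => n; rewrite /hs [in RHS]Hcoef0 plus_INR mult_INR.
by rewrite /plus /scal /= /mult /=; ring.
Qed.

Let s := sqrt (1 - 4 * I).
Let K := 2 / (1 + s).

Lemma I_small : Rabs I <= 1 / 25.
Proof. by have := Series_geom_dom _ _ iz_dom; rewrite -/I; lra. Qed.

Lemma s_sqr : s * s = 1 - 4 * I.
Proof. by have /Rabs_le_between h := I_small; rewrite /s sqrt_sqrt //; lra. Qed.

Lemma s_bounds : 9 / 10 < s.
Proof.
have /Rabs_le_between h := I_small; have := s_sqr; have : 0 <= s by apply: sqrt_pos.
nra.
Qed.

Lemma K_eq : I * K * K - K + 1 = 0.
Proof.
have := s_bounds => hs'; have e : I = (1 - s * s) / 4 by rewrite s_sqr; field.
by rewrite /K e; field; lra.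
Qed.

Lemma K_bounds : 0 < K < 2.
Proof.
have hs' := s_bounds; rewrite /K; split; first by apply: Rdiv_lt_0_compat; lra.
by apply/Rlt_div_l; lra.
Qed.

(* The recurrence in [d] has characteristic roots [K] and [1 / (I K)]; subtracting
   [K] times the previous term leaves the latter, which is too large for [H]. *)
Lemma H_iter d : H 1%nat - K * H 0%nat = (I * K) ^ d * (H d.+1 - K * H d).
Proof.
elim: d => [|d IH]; first by rewrite /=; ring.
have e : (I * K) * (H d.+2 - K * H d.+1) = H d.+1 - K * H d.
  have -> : H d = H d.+1 - I * H d.+2 by have := H_step d; lra.
  have k : I * K * K = K - 1 by have := K_eq; lra.
  have -> : I * K * (H d.+2 - K * H d.+1) = I * K * H d.+2 - I * K * K * H d.+1 by ring.
  by rewrite k; ring.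
by rewrite IH -e /=; ring.
Qed.

Lemma H_one : H 1%nat = K * H 0%nat.
Proof.
suff : H 1%nat - K * H 0%nat = 0 by lra.
apply: (geom_squeeze _ 20 (1 / 4)); first lra.
move=> d; rewrite (H_iter d) Rabs_mult -RPow_abs.
have q3 : 0 <= 3 ^ d by apply: pow_le; lra.
have h1 := Series_geom_dom _ _ (hs_dom d.+1); have h2 := Series_geom_dom _ _ (hs_dom d).
rewrite -!/(H _) in h1 h2.
have kb := K_bounds; have ib := I_small.
have b1 : Rabs (I * K) <= 1 / 12.
  by rewrite Rabs_mult (Rabs_pos_eq K); [have := Rabs_pos I; nra | lra].
have b2 : Rabs (H d.+1 - K * H d) <= 20 * 3 ^ d.
  apply: Rle_trans (Rabs_triang _ _) _; rewrite Rabs_Ropp Rabs_mult (Rabs_pos_eq K); last lra.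
  rewrite [3 ^ d.+1]/= in h1; have := Rabs_pos (H d); nra.
have -> : 20 * (1 / 4) ^ d = (1 / 12) ^ d * (20 * 3 ^ d).
  have -> : 1 / 4 = 1 / 12 * 3 by field.
  by rewrite Rpow_mult_distr; ring.
apply: Rmult_le_compat => //; [by apply: pow_le; exact: Rabs_pos | exact: Rabs_pos |].
by apply: pow_incr; split => //; exact: Rabs_pos.
Qed.

Lemma H_value : H 0%nat = / (s - z).
Proof.
have sb := s_bounds; move/Rabs_def2: z_small => zb.
have e : I = (1 - s * s) / 4 by rewrite s_sqr; field.
have := H_zero; rewrite H_one => h.
have h' : H 0%nat * (s - z) = 1.
  have -> : s = 1 - 2 * I * K by rewrite /K e; field; lra.
  by lra.
by apply: (Rmult_eq_reg_r (s - z)); [rewrite h'; field | ]; lra.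
Qed.

Lemma catC_value : catC (z ^ 3) = / (1 - I).
Proof.
have /Rabs_le_between ib := I_small; have ie := I_eq.
rewrite /catC; case: Req_EM_T => h; rewrite [is_left _]/=.
  have : I = 0 by rewrite h in ie; nra.
  by move=> ->; field.
have -> : sqrt (1 - 4 * z ^ 3) = 1 - 2 * I.
  have -> : 1 - 4 * z ^ 3 = (1 - 2 * I) * (1 - 2 * I) by lra.
  by rewrite sqrt_square //; lra.
have e3 : z ^ 3 = I * (1 - I) by lra.
rewrite e3 in h *; field; split; first lra.
by move=> e; apply: h; rewrite e; ring.
Qed.

Lemma sqrt_value : sqrt (catC (z ^ 3) * (4 - 3 * catC (z ^ 3))) = s / (1 - I).
Proof.
have /Rabs_le_between ib := I_small; have sb := s_bounds.
rewrite catC_value.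
have -> : / (1 - I) * (4 - 3 * / (1 - I)) = (s / (1 - I)) * (s / (1 - I)).
  have -> : s / (1 - I) * (s / (1 - I)) = (s * s) / ((1 - I) * (1 - I)) by field; lra.
  by rewrite s_sqr; field; lra.
rewrite sqrt_square //; apply: Rlt_le; apply: Rdiv_lt_0_compat; lra.
Qed.

Lemma closed_form_cat :
  catC (z ^ 3) / (sqrt (catC (z ^ 3) * (4 - 3 * catC (z ^ 3))) - z * catC (z ^ 3)) = H 0%nat.
Proof.
have /Rabs_le_between ib := I_small; have sb := s_bounds; move/Rabs_def2: z_small => zb.
by rewrite sqrt_value catC_value H_value; field; lra.
Qed.

Lemma closed_form_F : / (1 - z) * Ftx (2 / (1 - z)) (catC (z ^ 3) - 1) = H 0%nat.
Proof.
have /Rabs_le_between ib := I_small; have sb := s_bounds; move/Rabs_def2: z_small => zb.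
rewrite /Ftx /mtx; set x := catC (z ^ 3) - 1.
have -> : 1 - 2 * x - 3 * x ^ 2 = catC (z ^ 3) * (4 - 3 * catC (z ^ 3)) by rewrite /x; ring.
rewrite sqrt_value H_value /x catC_value.
have e : I = (1 - s * s) / 4 by rewrite s_sqr; field.
have d : / (1 - I) - 1 = I / (1 - I) by field; lra.
have -> : 1 - 2 * (2 / (1 - z)) * (/ (1 - I) - 1) + (/ (1 - I) - 1) + s / (1 - I) =
   (1 + s) * (s - z) / ((1 - I) * (1 - z)).
  by rewrite e; field; split; [lra | nra].
rewrite d [X in X / (1 - I)]e; field; repeat split; lra.
Qed.

Lemma a13_series : infinite_sum (fun n => INR (a13 n) * z ^ n) (H 0%nat).
Proof.
apply/is_series_Reals; apply: is_series_ext (is_series_hs 0%nat) => n.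
by rewrite /hs a13E.
Qed.

End Evaluation.

Theorem theorem4p9 :
  exists eps : R, 0 < eps /\
    forall z : R, Rabs z < eps ->
      infinite_sum (fun n => INR (a13 n) * z ^ n)
        (/ (1 - z) * Ftx (2 / (1 - z)) (catC (z ^ 3) - 1)) /\
      infinite_sum (fun n => INR (a13 n) * z ^ n)
        (catC (z ^ 3) /
           (sqrt (catC (z ^ 3) * (4 - 3 * catC (z ^ 3))) - z * catC (z ^ 3))).
Proof.
exists (1 / 1000); split; first lra.
by move=> z z_small; rewrite closed_form_F // closed_form_cat //; split; apply: a13_series.
Qed.
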